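(* Let $f:\mathbb R^n\to\mathbb R$ be locally Lipschitz and let $C\subset\mathbb R^n$ be closed and convex. Let $\mathscr O$ be a strict cutting plane oracle for $f$. Suppose $x^1\in C$ is such that the level set $\{x\in C: f(x)\le f(x^1)\}$ is bounded, and let $x^j\in C$ be the sequence of serious iterates generated by the bundle trust-region algorithm (described in the context) based on $\mathscr O$ and started at $x^1$. Then every accumulation point $x^*$ of the sequence $x^j$ is a critical point of $\min_{x\in C} f(x)$, i.e. $0\in\partial f(x^* )+N_C(x^* )$.
   Context: $\partial f$ is the Clarke subdifferential, $N_C$ the normal cone of convex analysis, $i_C$ the indicator function of $C$. $\|\cdot\|$ is a fixed norm on $\mathbb R^n$ (the trust-region norm), and $B(x,r)$ is the closed $\|\cdot\|$-ball. Cutting plane oracle. Fix $M>0$. A cutting plane oracle for $f$ is a set-valued operator $\mathscr O$ on $\mathbb R^n\times\mathbb R^n$ with values nonempty bounded subsets of $\mathbb R\times\mathbb R^n$, bounded on bounded sets; $(a,g)\in\mathscr O(z,x)$ represents the affine function (cutting plane) $a+g^{\mathsf T}(\cdot-x)$. It satisfies: $(\mathscr O_1)$ if $(a,g)\in\mathscr O(z,x)$, then $a\le f(x)$; moreover $\mathscr O(x,x)$ contains at least one element $(f(x),g)$ with $g\in\partial f(x)$; $(\mathscr O_2)$ if $(a_j,g_j)\in\mathscr O(z_j,x)$, $a_j\to f(x)$, $\|z_j-x\|\le M$, $g_j\to g$, then $g\in\partial f(x)$; $(\mathscr O_3)$ if $z_j\to x$, there exist $(a_j,g_j)\in\mathscr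 O(z_j,x)$ and $\epsilon_j\to0^+$ with $f(z_j)\le a_j+g_j^{\mathsf T}(z_j-x)+\epsilon_j\|z_j-x\|$; $(\mathscr O_4)$ if $z_j\to z$, $y_j\to y$, $x_j\to x$ with $\|z_j-x_j\|\le M$, and $(a_j,g_j)\in\mathscr O(z_j,x_j)$, then there exist $z'\in B(x,M)$ and $(a',g')\in\mathscr O(z',x)$ with $\limsup_j\, a_j+g_j^{\mathsf T}(y_j-x_j)\le a'+g'^{\mathsf T}(y-x)$. The oracle is strict if at every $x$ it satisfies: $(\widehat{\mathscr O}_3)$ for all $x_j,z_j\to x$ there exist $(a_j,g_j)\in\mathscr O(z_j,x_j)$ and $\epsilon_j\to0^+$ with $f(z_j)\le a_j+g_j^{\mathsf T}(z_j-x_j)+\epsilon_j\|z_j-x_j\|$. $M$ is understood to be large enough that all points $z$ at which the oracle is called by the algorithm at serious iterate $x$ satisfy $\|z-x\|\le M$. Algorithm. Parameters $0<\gamma<\widetilde\gamma<1$, $\gamma<\Gamma\le1$, $0<\theta\ll1$, $\Theta\ge1$, $q>0$. Start: $x^1\in C$, memory radius $R_1^\sharp>0$, symmetric $Q_1\succeq0$ with $\|Q_1\|\le q$, $j=1$. Outer loop at counter $j$: stop if $x^j$ is a critical point, i.e. $0\in\partial f(x^j)+N_C(x^j)$. Otherwise run the inner loop with $x=x^j$, $Q=Q_j$, starting at $k=1$ with $R_1=R_j^\sharp$. At inner counter $k$ there is a first-order working model $\phi_k(\cdot,x)=\sup\{a+g^{\mathsf T}(\cdot-x):(a,g)\in\mathscr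 W_k\}$ and a second-order working model $\Phi_k(\cdot,x)=\phi_k(\cdot,x)+\frac12(\cdot-x)^{\mathsf T}Q(\cdot-x)$. $\mathscr W_1$ consists of planes $(a,g)\in\mathscr O(z,x)$ (from $z=x$, or recycled from earlier trial points $z$ by calling the oracle for the new $x$) and contains at least one exactness plane, i.e. some $(f(x),g)\in\mathscr O(x,x)$. (Trial step) Compute a solution $y^k$ of the tangent program: minimize $\Phi_k(y,x)$ subject to $y\in C$, $\|y-x\|\le R_k$. By optimality there is an aggregate subgradient $g_k^*\in\partial(\phi_k(\cdot,x)+i_C)(y^k)$ with $g_k^*+Q(y^k-x)+v_k=0$, $v_k$ in the normal cone to $B(x,R_k)$ at $y^k$; the aggregate plane is $m_k^*(\cdot,x)=\phi_k(y^k,x)+g_k^{*\mathsf T}(\cdot-y^k)$. Choose as trial step any $z^k\in C$ with $f(x)-\Phi_k(z^k,x)\ge\theta\,(f(x)-\Phi_k(y^k,x))$ and $\|z^k-x\|\le\Theta\|y^k-x\|$. (Acceptance) If $\rho_k=\dfrac{f(x)-f(z^k)}{f(x)-\Phi_k(z^k,x)}\ge\gamma$, put $x^{j+1}=z^k$ (serious step), quit the inner loop, put $R_{j+1}^\sharp=R_k$ if $\rho_k<\Gamma$ and $R_{j+1}^\sharp=2R_k$ if $\rho_k\ge\Gamma$, choose $Q_{j+1}\succeq0$ symmetric with $\|Q_{j+1}\|\le q$, and increase $j$. (Null step) Otherwise form $\mathscr W_{k+1}$ so that it contains at least one exactness plane $(f(x),g)\in\mathscr O(x,x)$, the aggregate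 plane $m_k^*$, and all of $\mathscr O(z^k,x)$; any further elements of $\mathscr W_{k+1}$ must belong to $\mathscr W_k$ (elements of $\mathscr W_k$ may be dropped). Then compute $\widetilde\rho_k=\dfrac{f(x)-\phi_{k+1}(z^k,x)}{f(x)-\Phi_k(z^k,x)}$, put $R_{k+1}=R_k$ if $\widetilde\rho_k<\widetilde\gamma$ and $R_{k+1}=\frac12R_k$ if $\widetilde\rho_k\ge\widetilde\gamma$, increase $k$, and continue the inner loop. *)

(* Defs.v *)
From HB Require Import structures.
From mathcomp Require Import all_boot all_order all_algebra.
From mathcomp Require Import all_classical all_reals all_analysis.

Set Implicit Arguments.
Unset Strict Implicit.
Unset Printing Implicit Defensive.

Import Order.TTheory GRing.Theory Num.Theory.
Import numFieldNormedType.Exports.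

Local Open Scope classical_set_scope.
Local Open Scope ring_scope.

(* Topological notions on 'cV[R]_n (convergence, boundedness, closedness) are
   those of the library's sup norm; they agree with those of the trust-region
   norm [nrm], which is an arbitrary norm passed as a function. *)

Section ConvexAndNonsmoothAnalysis.
Context {R : realType}.

Record is_norm (E : lmodType R) (N : E -> R) : Prop := IsNorm {
  is_norm_triangle : forall x y, N (x + y) <= N x + N y ;
  is_norm_homogeneous : forall (a : R) x, N (a *: x) = `|a| * N x ;
  is_norm_definite : forall x, N x = 0 -> x = 0
}.

Context {n : nat}.
Local Notation V := 'cV[R]_n.

Definition dotp (u v : V) : R := (u^T *m v) 0 0.

Definition symmetric_psd (Q : 'M[R]_n) : Prop :=
  Q^T = Q /\ forall v : V, 0 <= dotp v (Q *m v).

Definition cball (nrm : V -> R) (x : V) (r : R) : set V :=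
  [set y | nrm (y - x) <= r].

Definition locally_lipschitz (f : V -> R) : Prop :=
  forall x : V, exists2 U : set V, nbhs x U & [lipschitz (f y : R^o) | y in U].

(* limsup of (f (u + t d) - f u) / t as u tends to x and t tends to 0+ *)
Definition clarke_dir (f : V -> R) (x d : V) : \bar R :=
  limf_esup (fun ut : V * R => ((f (ut.1 + ut.2 *: d) - f ut.1) / ut.2)%:E)
            (filter_prod (nbhs x) (0 : R)^'+).

Definition clarke_subdiff (f : V -> R) (x : V) : set V :=
  [set g | forall d : V, ((dotp g d)%:E <= clarke_dir f x d)%E].

(* empty at points outside C *)
Definition normal_cone (C : set V) (x : V) : set V :=
  [set v | C x /\ forall u, C u -> dotp v (u - x) <= 0].

Definition indicator (C : set V) (u : V) : \bar R :=
  if u \in C then 0%E else +oo%E.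

Definition convex_subdiff (h : V -> \bar R) (y : V) : set V :=
  [set g | h y \is a fin_num /\
           forall u, (h y + (dotp g (u - y))%:E <= h u)%E].

Definition critical (f : V -> R) (C : set V) (x : V) : Prop :=
  [set g + v | g in clarke_subdiff f x & v in normal_cone C x] 0.

End ConvexAndNonsmoothAnalysis.

Section Oracle.
Context {R : realType} {n : nat}.
Local Notation V := 'cV[R]_n.

(* A plane (a, g) attached to the serious iterate x stands for the affine
   function y |-> a + g^T (y - x). *)
Definition plane : Type := (R * V)%type.

Definition plane_at (x : V) (p : plane) (y : V) : R := p.1 + dotp p.2 (y - x).

(* [O z x] is the set of planes returned for the trial point z at the serious
   iterate x. *)
Record cutting_plane_oracle (f : V -> R) (nrm : V -> R) (M : R)
    (O : V -> V -> set plane) : Prop := CuttingPlaneOracle {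
  oracle_nonempty : forall z x, O z x !=set0 ;
  oracle_bounded : forall A : set (V * V),
    bounded_set A -> bounded_set (\bigcup_(zx in A) O zx.1 zx.2) ;
  oracle_O1_below : forall z x p, O z x p -> p.1 <= f x ;
  oracle_O1_exact : forall x, exists2 g, clarke_subdiff f x g & O x x (f x, g) ;
  oracle_O2 : forall (x : V) (z : nat -> V) (p : nat -> plane) (g : V),
    (forall j, O (z j) x (p j)) ->
    (fun j => (p j).1) @ \oo --> f x ->
    (forall j, nrm (z j - x) <= M) ->
    (fun j => (p j).2) @ \oo --> g ->
    clarke_subdiff f x g ;
  oracle_O3 : forall (x : V) (z : nat -> V),
    z @ \oo --> x ->
    exists (p : nat -> plane) (eps : nat -> R),
      [/\ forall j, O (z j) x (p j),
          forall j, 0 < eps j,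
          eps @ \oo --> (0 : R) &
          forall j, f (z j) <= plane_at x (p j) (z j) + eps j * nrm (z j - x)] ;
  oracle_O4 : forall (z y x : V) (zj yj xj : nat -> V) (p : nat -> plane),
    zj @ \oo --> z -> yj @ \oo --> y -> xj @ \oo --> x ->
    (forall j, nrm (zj j - xj j) <= M) ->
    (forall j, O (zj j) (xj j) (p j)) ->
    exists (z' : V) (p' : plane),
      [/\ cball nrm x M z', O z' x p' &
          (limn_esup (fun j => (plane_at (xj j) (p j) (yj j))%:E)
             <= (plane_at x p' y)%:E)%E]
}.

Definition strict_oracle (f : V -> R) (nrm : V -> R) (O : V -> V -> set plane)
    : Prop :=
  forall (x : V) (xj zj : nat -> V),
    xj @ \oo --> x -> zj @ \oo --> x ->
    exists (p : nat -> plane) (eps : nat -> R),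
      [/\ forall j, O (zj j) (xj j) (p j),
          forall j, 0 < eps j,
          eps @ \oo --> (0 : R) &
          forall j, f (zj j) <=
            plane_at (xj j) (p j) (zj j) + eps j * nrm (zj j - xj j)].

End Oracle.

Arguments plane : clear implicits.

Section Algorithm.
Context {R : realType} {n : nat}.
Local Notation V := 'cV[R]_n.
Local Notation plane := (plane R n).

Record btr_params := BtrParams {
  gamma : R ; gammat : R ; Gamma : R ; theta : R ; Theta : R ; qmax : R
}.

Record valid_params (prm : btr_params) : Prop := ValidParams {
  gamma_gt0 : 0 < gamma prm ;
  gamma_lt_gammat : gamma prm < gammat prm ;
  gammat_lt1 : gammat prm < 1 ;
  gamma_lt_Gamma : gamma prm < Gamma prm ;
  Gamma_le1 : Gamma prm <= 1 ;
  theta_gt0 : 0 < theta prm ;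
  theta_lt1 : theta prm < 1 ;
  Theta_ge1 : 1 <= Theta prm ;
  qmax_gt0 : 0 < qmax prm
}.

(* [sup] is the real-valued supremum (0 by convention on unbounded sets); it is
   a genuine supremum here because the working sets of the algorithm are
   nonempty and bounded. *)
Definition phi (W : set plane) (x y : V) : R :=
  sup [set plane_at x p y | p in W].

Definition Phi (W : set plane) (Q : 'M[R]_n) (x y : V) : R :=
  phi W x y + 2^-1 * dotp (y - x) (Q *m (y - x)).

(* y |-> phi W x yk + g^T (y - yk), written as a plane attached to x *)
Definition aggregate_plane (W : set plane) (x yk g : V) : plane :=
  (phi W x yk + dotp g (x - yk), g).

Definition rho (f : V -> R) (W : set plane) (Q : 'M[R]_n) (x z : V) : R :=
  (f x - f z) / (f x - Phi W Q x z).

Definition rho_tilde (f : V -> R) (W Wnext : set plane) (Q : 'M[R]_n)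
    (x z : V) : R :=
  (f x - phi Wnext x z) / (f x - Phi W Q x z).

Definition exactness_planes (f : V -> R) (O : V -> V -> set plane) (x : V)
    : set plane :=
  [set p | O x x p /\ p.1 = f x].

(* y solves the tangent program with radius r, g is an aggregate subgradient at
   y, and z is an admissible trial step *)
Record trial_step (f : V -> R) (C : set V) (nrm : V -> R) (prm : btr_params)
    (x : V) (Q : 'M[R]_n) (W : set plane) (r : R) (y g z : V) : Prop :=
  TrialStep {
  tangent_feasible : C y /\ cball nrm x r y ;
  tangent_optimal : forall u, C u -> cball nrm x r u ->
    Phi W Q x y <= Phi W Q x u ;
  aggregate_subgradient :
    convex_subdiff (fun u => ((phi W x u)%:E + indicator C u)%E) y g ;
  aggregate_equation : exists2 v, normal_cone (cball nrm x r) y v &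
    g + Q *m (y - x) + v = 0 ;
  trial_feasible : C z ;
  trial_decrease :
    theta prm * (f x - Phi W Q x y) <= f x - Phi W Q x z ;
  trial_length : nrm (z - x) <= Theta prm * nrm (y - x)
}.

Record working_set_update (f : V -> R) (O : V -> V -> set plane)
    (x y g z : V) (W Wnext : set plane) : Prop := WorkingSetUpdate {
  update_exactness : Wnext `&` exactness_planes f O x !=set0 ;
  update_aggregate : Wnext (aggregate_plane W x y g) ;
  update_cutting : O z x `<=` Wnext ;
  update_rest : Wnext `<=` W `|` exactness_planes f O x
                           `|` [set aggregate_plane W x y g] `|` O z x
}.

(* Data of one completed inner loop. Inner counters start at 0 and the serious
   step is the one with counter [serious], so the null steps are those with
   counter k < serious. [recycled] is the set of earlier trial points at which
   the oracle is called again to build the first working set. *)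
Record inner_loop := InnerLoop {
  recycled : set V ;
  serious : nat ;
  planes : nat -> set plane ;
  radius : nat -> R ;
  tangent : nat -> V ;
  aggsub : nat -> V ;
  trial : nat -> V
}.

Record inner_loop_spec (f : V -> R) (C : set V) (O : V -> V -> set plane)
    (nrm : V -> R) (prm : btr_params) (earlier : set V) (x : V) (Q : 'M[R]_n)
    (Rsharp : R) (L : inner_loop) : Prop := InnerLoopSpec {
  il_recycled : recycled L `<=` earlier ;
  il_planes0 : planes L 0%N `<=` \bigcup_(z in x |` recycled L) O z x ;
  il_exactness0 : planes L 0%N `&` exactness_planes f O x !=set0 ;
  il_radius0 : radius L 0%N = Rsharp ;
  il_trial : forall k, (k <= serious L)%N ->
    trial_step f C nrm prm x Q (planes L k) (radius L k)
      (tangent L k) (aggsub L k) (trial L k) ;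
  il_null_rho : forall k, (k < serious L)%N ->
    rho f (planes L k) Q x (trial L k) < gamma prm ;
  il_null_planes : forall k, (k < serious L)%N ->
    working_set_update f O x (tangent L k) (aggsub L k) (trial L k)
      (planes L k) (planes L k.+1) ;
  il_null_radius : forall k, (k < serious L)%N ->
    radius L k.+1 =
      if rho_tilde f (planes L k) (planes L k.+1) Q x (trial L k) < gammat prm
      then radius L k else radius L k / 2 ;
  il_serious_rho :
    gamma prm <= rho f (planes L (serious L)) Q x (trial L (serious L))
}.

(* points at which the oracle is called at serious iterate x during L *)
Definition oracle_calls (x : V) (L : inner_loop) : set V :=
  x |` recycled L `|` [set trial L k | k in `I_(serious L)].

(* Data of an execution that generates infinitely many serious iterates. The
   outer counter starts at 0, so [iterate 0] is the starting point. *)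
Record btr_run := BtrRun {
  iterate : nat -> V ;
  memory : nat -> R ;
  hess : nat -> 'M[R]_n ;
  inner : nat -> inner_loop
}.

Definition earlier_trials (run : btr_run) (j : nat) : set V :=
  [set z | exists i k, [/\ (i < j)%N, (k <= serious (inner run i))%N &
                           z = trial (inner run i) k]].

(* [mnrm] is the norm in which the matrices Q_j are bounded by q *)
Record bundle_trust_region (f : V -> R) (C : set V) (O : V -> V -> set plane)
    (nrm : V -> R) (mnrm : 'M[R]_n -> R) (prm : btr_params) (x1 : V)
    (run : btr_run) : Prop := BundleTrustRegion {
  btr_start : iterate run 0%N = x1 ;
  btr_startC : C x1 ;
  btr_memory0 : 0 < memory run 0%N ;
  btr_hess : forall j, symmetric_psd (hess run j) /\
    mnrm (hess run j) <= qmax prm ;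
  btr_continue : forall j, ~ critical f C (iterate run j) ;
  btr_inner : forall j,
    inner_loop_spec f C O nrm prm (earlier_trials run j) (iterate run j)
      (hess run j) (memory run j) (inner run j) ;
  btr_iterate : forall j,
    iterate run j.+1 = trial (inner run j) (serious (inner run j)) ;
  btr_memory : forall j,
    let L := inner run j in let K := serious L in
    memory run j.+1 =
      if rho f (planes L K) (hess run j) (iterate run j) (trial L K)
           < Gamma prm
      then radius L K else 2 * radius L K
}.

End Algorithm.

Arguments btr_params : clear implicits.
Arguments inner_loop : clear implicits.
Arguments btr_run : clear implicits.

(* Main.v *)
Require Import Defs.
From HB Require Import structures.
From mathcomp Require Import all_boot all_order all_algebra.
From mathcomp Require Import all_classical all_reals all_analysis.
From mathcomp Require Import ring lra.

Set Implicit Arguments.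
Unset Strict Implicit.
Unset Printing Implicit Defensive.

Import Order.TTheory GRing.Theory Num.Theory.
Import numFieldNormedType.Exports.

Local Open Scope classical_set_scope.
Local Open Scope ring_scope.

(* Write y for the tangent step at the serious iterate x with radius r,
   w = y - x, delta = f x - Phi(y) for the decrease predicted by the model and v
   for the multiplier of the ball, so that the aggregate subgradient is
   -(Q w) - v.

   Every plane of a working model is dominated on C by planes the oracle returns
   at points of B(x, M), and by (O4) the supremum of the latter is upper
   semicontinuous in x.  Hence if x -> x*, delta -> 0 and v -> 0 along some tangent
   steps, x* minimises this supremum over C; by (O2) and a minimax argument x*
   is critical.  So near a noncritical x* a small delta forces v away from 0, and
   since v is normal to the ball at y, delta >= kappa r.

   Suppose the accumulation point x* is not critical.  At serious steps
   delta -> 0, so the step lengths, at most a multiple of r, are dominated by the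
   decrease of f.  The iterates are then trapped near x*, the whole sequence
   converges to x* and the radii tend to 0; in particular the radius is halved at
   infinitely many null steps, which have x, z -> x* and r -> 0.  There the strict
   oracle gives f z - phi(z) = o(|z - x|) = o(r) = o(delta), which contradicts the
   gap between rho < gamma and rho~ >= gammat. *)

(** * The Euclidean inner product on columns *)

Section Dotp.
Context {R : realType} {n : nat}.
Implicit Types u v w : 'cV[R]_n.

Lemma dotpE u v : dotp u v = \sum_i u i 0 * v i 0.
Proof. by rewrite /dotp mxE; apply: eq_bigr => i _; rewrite mxE. Qed.

Lemma dotpC u v : dotp u v = dotp v u.
Proof. by rewrite !dotpE; apply: eq_bigr => i _; rewrite mulrC. Qed.

Lemma dotpDr u v w : dotp u (v + w) = dotp u v + dotp u w.
Proof. by rewrite /dotp mulmxDr mxE. Qed.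

Lemma dotpZr a u v : dotp u (a *: v) = a * dotp u v.
Proof. by rewrite /dotp -scalemxAr mxE. Qed.

Lemma dotpNr u v : dotp u (- v) = - dotp u v.
Proof. by rewrite /dotp mulmxN mxE. Qed.

Lemma dotpBr u v w : dotp u (v - w) = dotp u v - dotp u w.
Proof. by rewrite dotpDr dotpNr. Qed.

Lemma dotp0r u : dotp u 0 = 0.
Proof. by rewrite /dotp mulmx0 mxE. Qed.

Lemma dotpDl u v w : dotp (u + v) w = dotp u w + dotp v w.
Proof. by rewrite ![dotp _ w]dotpC dotpDr. Qed.

Lemma dotpZl a u v : dotp (a *: u) v = a * dotp u v.
Proof. by rewrite ![dotp _ v]dotpC dotpZr. Qed.

Lemma dotpNl u v : dotp (- u) v = - dotp u v.
Proof. by rewrite ![dotp _ v]dotpC dotpNr. Qed.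

Lemma dotpBl u v w : dotp (u - v) w = dotp u w - dotp v w.
Proof. by rewrite dotpDl dotpNl. Qed.

Lemma dotp0l u : dotp 0 u = 0.
Proof. by rewrite dotpC dotp0r. Qed.

Lemma dotp_ge0 u : 0 <= dotp u u.
Proof. by rewrite dotpE; apply: sumr_ge0 => i _; rewrite -expr2 sqr_ge0. Qed.

Lemma dotp_mulmx (Q : 'M[R]_n) u v : dotp u (Q *m v) = dotp (Q^T *m u) v.
Proof. by rewrite /dotp trmx_mul trmxK mulmxA. Qed.

End Dotp.

(** * Sup norm estimates for matrices and inner products *)

Section MatrixNorm.
Context {R : realType}.

Lemma mx_norm_ge_entry m n (A : 'M[R]_(m, n)) i j : `|A i j| <= `|A|.
Proof.
rewrite [leRHS]/Num.norm /= mx_normrE; apply/bigmax_geP; right => /=.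
by exists (i, j).
Qed.

Lemma mx_norm_le m n (A : 'M[R]_(m, n)) c :
  0 <= c -> (forall i j, `|A i j| <= c) -> `|A| <= c.
Proof.
move=> c0 Ac; rewrite [leLHS]/Num.norm /= mx_normrE.
by apply/bigmax_leP; split=> // -[i j] _ /=.
Qed.

Lemma mx_norm_mulmx m n p (A : 'M[R]_(m, n)) (B : 'M[R]_(n, p)) :
  `|A *m B| <= n%:R * `|A| * `|B|.
Proof.
apply: mx_norm_le => [|i j]; first by rewrite !mulr_ge0.
rewrite mxE (le_trans (ler_norm_sum _ _ _))//.
rewrite -mulrA mulr_natl -[X in _ *+ X]card_ord -sumr_const.
by apply: ler_sum => k _; rewrite normrM ler_pM// mx_norm_ge_entry.
Qed.

Lemma dotp_le n (u v : 'cV[R]_n) : `|dotp u v| <= n%:R * `|u| * `|v|.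
Proof.
rewrite dotpE (le_trans (ler_norm_sum _ _ _))//.
rewrite -mulrA mulr_natl -[X in _ *+ X]card_ord -sumr_const.
by apply: ler_sum => k _; rewrite normrM ler_pM// mx_norm_ge_entry.
Qed.

Lemma sqr_mx_norm_le_dotp n (u : 'cV[R]_n) : `|u| ^+ 2 <= dotp u u.
Proof.
rewrite -[leRHS]sqr_sqrtr ?dotp_ge0// lerXn2r ?nnegrE ?sqrtr_ge0//.
apply: mx_norm_le => [|i j]; first exact: sqrtr_ge0.
rewrite -sqrtr_sqr ler_wsqrtr// ord1 dotpE (bigD1 i)//= expr2 lerDl.
by apply: sumr_ge0 => k _; rewrite -expr2 sqr_ge0.
Qed.

Lemma dotp_eq0 n (u : 'cV[R]_n) : dotp u u <= 0 -> u = 0.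
Proof.
move=> u0; apply/eqP; rewrite -normr_eq0 -sqrf_eq0.
by rewrite eq_le sqr_ge0 andbT (le_trans (sqr_mx_norm_le_dotp u)).
Qed.

Lemma mx_norm_mxvec m n (A : 'M[R]_(m, n)) : `|mxvec A| = `|A|.
Proof.
apply/eqP; rewrite eq_le; apply/andP; split; apply: mx_norm_le => // i j.
  by case/mxvec_indexP: j => k l; rewrite ord1 mxvecE mx_norm_ge_entry.
by rewrite -mxvecE mx_norm_ge_entry.
Qed.

End MatrixNorm.

(** * Subsequences and limits *)

Section Sequences.
Context {R : realType}.

(** The condition [k <= h k] stands in for strict monotonicity of [h]: it already makes [h] tend to
    infinity, and indices obtained by choice satisfy it directly. *)
Lemma cvg_subseq (T : topologicalType) (u : nat -> T) (l : T) (h : nat -> nat) :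
  (forall k, (k <= h k)%N) -> u @ \oo --> l -> (u \o h) @ \oo --> l.
Proof.
move=> hk ul; apply: cvg_comp ul => A [N _ NA]; exists N => // k /= Nk.
by apply: NA => /=; exact: leq_trans (hk k).
Qed.

Lemma cluster_subseq (V : normedModType R) (u : nat -> V) (l : V) :
  cluster (u @ \oo) l ->
  exists2 h : nat -> nat, forall k, (k <= h k)%N & (u \o h) @ \oo --> l.
Proof.
move=> ul.
have /choice[h hP] : forall k, exists i, (k <= i)%N /\ `|l - u i| < k.+1%:R^-1.
  move=> k; have k0 : 0 < (k.+1%:R^-1 : R) by rewrite invr_gt0.
  have [||v [[i ki <-]] ] := ul [set u i | i in [set i | (k <= i)%N]]
    [set v | `|l - v| < k.+1%:R^-1].
  - by exists k => // i /= ki; exists i.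
  - by apply/nbhs_normP; exists k.+1%:R^-1.
  - by exists i.
exists h => [k|]; first by have [] := hP k.
apply/cvgrPdist_lt => e e0.
have := near_infty_natSinv_lt (PosNum e0); apply: filterS => k /=.
by apply: lt_trans; have [] := hP k.
Qed.

(** Bolzano-Weierstrass. Matrices are flattened by [mxvec], which preserves the sup norm, so that
    compactness of closed bounded sets of row vectors applies. *)
Lemma bounded_seq_subseq m n (u : nat -> 'M[R]_(m, n)) (c : R) :
  (forall k, `|u k| <= c) ->
  exists (l : 'M[R]_(m, n)) (h : nat -> nat),
    (forall k, (k <= h k)%N) /\ (u \o h) @ \oo --> l.
Proof.
move=> uc.
have cA : compact [set v : 'rV[R]_(m * n) | `|v| <= c].
  apply: bounded_closed_compact.
    by exists c; split; [exact: num_real|move=> x cx v /= /le_trans; apply; exact: ltW].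
  rewrite (_ : [set v | _] = Num.norm @^-1` [set x : R | x <= c])//.
  apply: preimage_closed; last exact: closed_le.
  by move=> x _; exact: norm_continuous.
have [|l [_ ul]] := cA ((mxvec \o u) @ \oo) _.
  by exists 0%N => // k _ /=; rewrite mx_norm_mxvec.
have [h hk hl] := cluster_subseq ul.
exists (vec_mx l), h; split=> //; apply/cvgrPdist_lt => e e0.
move/cvgrPdist_lt : hl => /(_ e e0); apply: filterS => k /=.
by rewrite -[X in _ -> X < _]mx_norm_mxvec linearB /= vec_mxK.
Qed.

Lemma cvg_dotp n (T : Type) (F : set_system T) {FF : Filter F}
    (u v : T -> 'cV[R]_n) (a b : 'cV[R]_n) :
  u @ F --> a -> v @ F --> b -> dotp (u k) (v k) @[k --> F] --> dotp a b.
Proof.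
move=> ua vb.
have -> : (fun k => dotp (u k) (v k)) = (fun k => \sum_(i < n) (u k i 0 * v k i 0)).
  by apply/funext => k; rewrite dotpE.
rewrite dotpE; apply: cvg_big => [|i _]; first exact: add_continuous.
have coord (w : T -> 'cV[R]_n) (c : 'cV[R]_n) :
    w @ F --> c -> (w k i 0) @[k --> F] --> c i 0.
  move=> wc; apply: (@cvg_comp _ _ _ w (fun A : 'cV[R]_n => A i 0) _ _ _ wc).
  exact: coord_continuous.
by apply: cvgM; exact: coord.
Qed.

Lemma le_cvg_seq (u v : nat -> R) (a b : R) :
  u @ \oo --> a -> v @ \oo --> b -> (forall k, u k <= v k) -> a <= b.
Proof.
by move=> ua vb uv; apply: (ler_cvg_to ua vb); exact: nearW.
Qed.

Lemma cvg_harmonicD (a : R) : (a + k.+1%:R^-1) @[k --> \oo] --> a.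
Proof.
rewrite -[X in _ --> X]addr0; apply: cvgD; first exact: cvg_cst.
exact: cvg_harmonic.
Qed.

Lemma cvg_norm_le_harmonic (V : normedModType R) (u : nat -> V) (l : V) :
  (forall k, `|u k - l| <= k.+1%:R^-1) -> u @ \oo --> l.
Proof.
move=> ul; apply/cvgrPdist_lt => e e0.
apply: filterS (near_infty_natSinv_lt (PosNum e0)) => k /=.
by apply: le_lt_trans; rewrite distrC.
Qed.

End Sequences.

(** * Equivalence of norms in finite dimension *)

Section NormEquivalence.
Context {R : realType}.

Section NormTheory.
Context (E : lmodType R) (N : E -> R) (hN : is_norm N).

Lemma is_norm0 : N 0 = 0.
Proof. by rewrite -(scale0r 0) (is_norm_homogeneous hN) normr0 mul0r. Qed.

Lemma is_normN x : N (- x) = N x.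
Proof. by rewrite -scaleN1r (is_norm_homogeneous hN) normrN1 mul1r. Qed.

Lemma is_norm_ge0 x : 0 <= N x.
Proof.
have := is_norm_triangle hN x (- x).
by rewrite subrr is_norm0 is_normN; lra.
Qed.

Lemma is_norm_gt0 x : x != 0 -> 0 < N x.
Proof.
move=> x0; rewrite lt_def is_norm_ge0 andbT.
by apply: contraNN x0 => /eqP /(is_norm_definite hN) ->.
Qed.

Lemma is_norm_sum I (r : seq I) (F : I -> E) :
  N (\sum_(i <- r) F i) <= \sum_(i <- r) N (F i).
Proof.
elim: r => [|i r ih]; first by rewrite !big_nil is_norm0.
by rewrite !big_cons (le_trans (is_norm_triangle hN _ _))// lerD2l.
Qed.

End NormTheory.

Context {m n : nat} (N : 'M[R]_(m, n) -> R) (hN : is_norm N).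

Lemma norm_le_mx_norm : exists2 c : R, 0 < c & forall A, N A <= c * `|A|.
Proof.
exists (1 + \sum_i \sum_j N (delta_mx i j)).
  by rewrite ltr_pwDl// sumr_ge0// => i _; rewrite sumr_ge0// => j _;
    exact: is_norm_ge0.
move=> A; rewrite {1}(matrix_sum_delta A) (le_trans (is_norm_sum hN _ _))//.
rewrite mulrDl mul1r (@le_trans _ _ ((\sum_i \sum_j N (delta_mx i j)) * `|A|))//;
  last by rewrite lerDr.
rewrite mulr_suml; apply: ler_sum => i _.
rewrite (le_trans (is_norm_sum hN _ _))// mulr_suml; apply: ler_sum => j _.
rewrite (is_norm_homogeneous hN) mulrC ler_wpM2l ?mx_norm_ge_entry//.
exact: is_norm_ge0.
Qed.

(** If no constant works, normalising gives matrices of sup norm 1 on which [N] tends to 0. A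
    subsequential limit has sup norm 1 and, by [norm_le_mx_norm], [N] vanishes there. *)
Lemma mx_norm_le_norm : exists2 c : R, 0 < c & forall A, `|A| <= c * N A.
Proof.
apply: contrapT => noc.
have /choice[u uP] : forall k, exists A, `|A| = 1 /\ N A <= k.+1%:R^-1.
  move=> k; apply: contrapT => noA; apply: noc; exists k.+1%:R => // A.
  have [->|A0] := eqVneq A 0; first by rewrite normr0 mulr_ge0// is_norm_ge0.
  rewrite leNgt; apply/negP => kA; apply: noA; exists (`|A|^-1 *: A); split.
    by rewrite normrZ normfV normr_id mulVf// normr_eq0.
  rewrite (is_norm_homogeneous hN) normfV normr_id mulrC ler_pdivrMr ?normr_gt0//.
  by rewrite mulrC ler_pdivlMr// mulrC ltW.
have u1 k : `|u k| <= 1 by rewrite (uP k).1.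
have [l [h [hk ul]]] := bounded_seq_subseq u1.
have l1 : `|l| = 1.
  apply: (@norm_cvg_unique _ R (`|u (h k)| @[k --> \oo])).
    exact: cvg_norm ul.
  rewrite (_ : (fun k => _) = cst 1); first exact: cvg_cst.
  by apply/funext => k; rewrite (uP (h k)).1.
have [c c0 Nc] := norm_le_mx_norm.
suff /(is_norm_definite hN) l0 : N l = 0.
  by move: l1; rewrite l0 normr0 => /eqP; rewrite eq_sym oner_eq0.
apply/eqP; rewrite eq_le is_norm_ge0// andbT; apply/ler_addgt0Pr => e e0.
rewrite add0r.
have e2c : 0 < e / 2 / c by rewrite !divr_gt0.
have e2 : 0 < e / 2 by rewrite divr_gt0.
near \oo => k.
have lk : `|l - u (h k)| < e / 2 / c.
  by near: k; move/cvgrPdist_lt : ul; apply.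
rewrite -(subrK (u (h k)) l) (le_trans (is_norm_triangle hN _ _))//.
rewrite (splitr e) lerD//.
  by rewrite (le_trans (Nc _))// mulrC -ler_pdivlMr// ltW.
rewrite (le_trans (uP (h k)).2)// (@le_trans _ _ k.+1%:R^-1)//.
  by rewrite lef_pV2 ?posrE// ler_nat ltnS hk.
by apply: ltW; near: k; exact: (near_infty_natSinv_lt (PosNum e2)).
Unshelve. all: by end_near. Qed.

End NormEquivalence.

(** * Projections and a minimax argument for convex sets *)

Section Convexity.
Context {R : realType} {n : nat}.
Local Notation V := 'cV[R]_n.
Implicit Types (C K : set V) (x u g : V).

Lemma convex_set_segment C : convex_set C ->
  forall x u t, C x -> C u -> 0 <= t <= 1 -> C (x + t *: (u - x)).
Proof.
move=> Cc x u t Cx Cu /andP[t0 t1].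
have := Cc u x (Itv01 t0 t1); rewrite !inE => /(_ Cu Cx).
rewrite /conv/= (_ : t *: u + _ = x + t *: (u - x))//.
by rewrite scalerBl scale1r scalerBr addrCA.
Qed.

(** Let [t] tend to 0. This turns the comparison of a minimiser with the points of a segment into a
    first-order inequality. *)
Lemma le0_of_le_scale (a b : R) :
  (forall t, 0 < t <= 1 -> a <= t * b) -> a <= 0.
Proof.
move=> ab; rewrite leNgt; apply/negP => a0.
have b0 : 0 < b by apply: lt_le_trans a0 _; rewrite -[b]mul1r ab// ltr01 lexx.
have s0 : 0 < a + 2 * b by lra.
have /ab : 0 < a / (a + 2 * b) <= 1.
  by rewrite divr_gt0//= ler_pdivrMr// mul1r; lra.
rewrite mulrAC ler_pdivlMr// => h.
have h1 := mulr_gt0 a0 a0; have h2 := mulr_gt0 a0 b0. lra.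
Qed.

(** A minimising sequence for the squared Euclidean distance to [p] is bounded and subconverges to
    [u]; comparing [u] with the points of the segment towards [c] gives the angle inequality. *)
Lemma projection_exists C : closed C -> convex_set C -> C !=set0 ->
  forall p, exists2 u, C u & forall c, C c -> dotp (p - u) (c - u) <= 0.
Proof.
move=> Ccl Ccv [c0 Cc0] p.
pose D := [set dotp (p - c) (p - c) | c in C].
have D0 : lbound D 0 by move=> _ [c _ <-]; exact: dotp_ge0.
have hD : has_inf D by split; [exists (dotp (p - c0) (p - c0)), c0|exists 0].
have /choice[c cP] : forall k, exists c, C c /\
    dotp (p - c) (p - c) <= inf D + k.+1%:R^-1.
  move=> k; have k0 : 0 < (k.+1%:R^-1 : R) by rewrite invr_gt0.
  by have [_ [c Cc <-] /ltW] := inf_adherent k0 hD; exists c.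
have cb k : `|c k| <= `|p| + (inf D + 2).
  rewrite -[c k](subKr p) (le_trans (ler_normB _ _))// lerD2l.
  have := le_trans (sqr_mx_norm_le_dotp _) (cP k).2.
  have : (k.+1%:R^-1 : R) <= 1 by rewrite invf_le1 ?ler1n.
  have := sqr_ge0 (`|p - c k| - 2^-1); rewrite !expr2.
  by move: (k.+1%:R^-1) => r; set N := `|_|; lra.
have [u [h [hk cu]]] := bounded_seq_subseq cb.
have Cu : C u.
  by apply: (closed_cvg _ Ccl _ _ cu); apply: nearW => k; have [] := cP (h k).
have pu : dotp (p - u) (p - u) <= inf D.
  have pcu : (p - c (h k)) @[k --> \oo] --> p - u by apply: cvgB => //; exact: cvg_cst.
  have Dk := cvg_subseq hk (@cvg_harmonicD R (inf D)).
  apply: (le_cvg_seq (cvg_dotp pcu pcu) Dk) => k /=.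
  by have [] := cP (h k).
exists u => // e Ce.
suff : 2 * dotp (p - u) (e - u) <= 0 by lra.
apply: (@le0_of_le_scale _ (dotp (e - u) (e - u))) => t /andP[t0 t1].
have /(ge_inf (ex_intro _ _ D0)) :
    D (dotp (p - (u + t *: (e - u))) (p - (u + t *: (e - u)))).
  by exists (u + t *: (e - u)) => //; apply: convex_set_segment; rewrite // ltW.
move/(le_trans pu); rewrite opprD addrA !(dotpBl (p - u)) !(dotpBr _ (p - u)).
rewrite !dotpZl !dotpZr [dotp (e - u) (p - u)]dotpC => h0.
rewrite -(ler_pM2l t0); lra.
Qed.

(* A minimiser over K of h g = max_(u in C) (- g.(u - x) - |u - x|^2 / 2), the
   maximum being attained at the projection P g of x - g onto C, is such a
   multiplier. *)
Lemma uniform_ascent_multiplier C K x :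
  closed C -> convex_set C -> C x ->
  closed K -> convex_set K -> (exists B, forall g, K g -> `|g| <= B) ->
  (forall u, C u -> exists2 g, K g & 0 <= dotp g (u - x)) ->
  exists2 g, K g & forall u, C u -> 0 <= dotp g (u - x).
Proof.
move=> Ccl Ccv Cx Kcl Kcv [B KB] CK.
have C0 : C !=set0 by exists x.
have /choice[P PP] : forall g, exists u, C u /\
    forall c, C c -> dotp (x - g - u) (c - u) <= 0.
  by move=> g; have [u] := projection_exists Ccl Ccv C0 (x - g); exists u.
pose F g u := - dotp g (u - x) - 2^-1 * dotp (u - x) (u - x).
(* Completing the square: up to a term depending on [g] only, [F g u] is minus half the squared
   distance from [u] to x - g, so the projection [P g] maximises it. *)
have FP g u : C u -> F g u <= F g (P g).
  move=> Cu; have [_ /(_ _ Cu)] := PP g; rewrite /F.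
  set a := P g - x; set b := u - x.
  have -> : x - g - P g = - (g + a) by apply/matrixP => i j; rewrite !mxE; ring.
  have -> : u - P g = b - a by apply/matrixP => i j; rewrite !mxE; ring.
  move: a b => a b; have := dotp_ge0 (a - b).
  rewrite dotpNl !(dotpBl, dotpBr, dotpDl, dotpDr) (dotpC b a); lra.
have F0 g : 0 <= F g (P g).
  by rewrite (le_trans _ (FP g _ Cx))// /F subrr !dotp0r; lra.
pose D := [set F g (P g) | g in K].
have D0 : lbound D 0 by move=> _ [g _ <-].
have hD : has_inf D.
  by split; [have [g Kg _] := CK _ Cx; exists (F g (P g)), g|exists 0].
have /choice[g gP] : forall k, exists g, K g /\ F g (P g) <= inf D + k.+1%:R^-1.
  move=> k; have k0 : 0 < (k.+1%:R^-1 : R) by rewrite invr_gt0.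
  by have [_ [g Kg <-] /ltW] := inf_adherent k0 hD; exists g.
have [l [h [hk gl]]] := bounded_seq_subseq (fun k => KB _ (gP k).1).
have Kl : K l.
  by apply: (closed_cvg _ Kcl _ _ gl); apply: nearW => k; have [] := gP (h k).
have Fl u : C u -> F l u <= inf D.
  move=> Cu; have Fgl : F (g (h k)) u @[k --> \oo] --> F l u.
    apply: cvgB; last exact: cvg_cst.
    by apply: cvgN; apply: cvg_dotp => //; exact: cvg_cst.
  have Dk := cvg_subseq hk (@cvg_harmonicD R (inf D)).
  apply: (le_cvg_seq Fgl Dk) => k /=.
  by rewrite (le_trans (FP _ _ Cu))// (gP (h k)).2.
(* First-order optimality of [l]. Comparing [F l] with [F gt] at [P gt] gives t (e - l).(P gt - x)
   <= 0, and the two projection inequalities show that replacing [P gt] by [P l] costs only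
   O(t^2). *)
have Kle e : K e -> dotp e (P l - x) <= dotp l (P l - x).
  move=> Ke; rewrite -subr_le0 -dotpBl.
  apply: (@le0_of_le_scale _ (dotp (e - l) (e - l))) => t /andP[t0 t1].
  pose gt := l + t *: (e - l).
  have Kgt : K gt by apply: convex_set_segment; rewrite // ltW.
  have [Ct Pt] := PP gt.
  have := le_trans (Fl _ Ct) (ge_inf (ex_intro _ _ D0) (ex_intro2 _ _ gt Kgt erefl)).
  have gtE w : dotp gt w = dotp l w + t * dotp (e - l) w by rewrite /gt dotpDl dotpZl.
  rewrite /F gtE => h1.
  have h2 := Pt _ (PP l).1; have h3 := (PP l).2 _ Ct.
  have h4 := dotp_ge0 (P gt - P l + t *: (e - l)).
  rewrite -(ler_pM2l t0).
  have h5 : dotp (x - l - P l - (t *: (e - l) + (P gt - P l))) (- (P gt - P l)) <= 0.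
    apply: le_trans h2; rewrite opprB le_eqVlt; apply/orP; left; apply/eqP.
    by congr dotp; apply/matrixP => i j; rewrite !mxE; ring.
  have -> : P l - x = (P gt - x) - (P gt - P l).
    by apply/matrixP => i j; rewrite !mxE; ring.
  move: h1 h3 h4 h5; move: (P gt - x) (x - l - P l) (P gt - P l) (e - l) => a b w d.
  rewrite !(dotpBl, dotpBr, dotpDl, dotpDr, dotpZl, dotpZr, dotpNr, dotpNl).
  by rewrite (dotpC w d); lra.
have [CPl Pl] := PP l.
have [e Ke e0] := CK _ CPl.
(* The hypothesis at u = P l yields l.(P l - x) >= 0, while [F l (P l) >= 0] bounds this product
   above by -|P l - x|^2 / 2. *)
have Plx : P l = x.
  apply/eqP; rewrite -subr_eq0; apply/eqP/dotp_eq0.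
  have := F0 l; rewrite /F; have := le_trans e0 (Kle _ Ke); lra.
exists l => // u Cu; have := Pl _ Cu; rewrite Plx addrAC subrr add0r dotpNl; lra.
Qed.

End Convexity.

(** * Closedness, convexity and boundedness of the Clarke subdifferential *)

Section Clarke.
Context {R : realType} {n : nat}.
Local Notation V := 'cV[R]_n.
Context (f : V -> R) (fL : locally_lipschitz f).

Lemma locally_lipschitz_bound (x : V) : exists2 U : set V, nbhs x U &
  exists2 L : R, 0 < L & forall y z, U y -> U z -> `|f y - f z| <= L * `|y - z|.
Proof.
have [U xU /pinfty_ex_gt0[L L0 UL]] := fL x.
exists U => //; exists L => // y z Uy Uz.
exact: (UL (y, z)).
Qed.

Lemma locally_lipschitz_continuous : continuous f.
Proof.
move=> x; have [U xU [L L0 UL]] := locally_lipschitz_bound x.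
apply/(@cvgrPdist_lt _ _ _ _ (nbhs_filter x)) => e e0.
have eL : nbhs x (ball x (e / L)) by apply: nbhsx_ballx; exact: divr_gt0.
apply: filterS (filterI xU eL) => y [Uy].
rewrite -ball_normE /= ltr_pdivlMr// mulrC => ye.
exact: le_lt_trans (UL _ _ (nbhs_singleton xU) Uy) ye.
Qed.

Lemma clarke_subdiff_closed x : closed (clarke_subdiff f x).
Proof.
rewrite (_ : clarke_subdiff f x =
  \bigcap_d [set g | ((dotp g d)%:E <= clarke_dir f x d)%E]); last first.
  by apply/seteqP; split => g h d => [_|]; [exact: h | exact: (h d I)].
apply: closed_bigI => d _.
case: (clarke_dir f x d) => [r||].
- rewrite (_ : [set g | _] = dotp ^~ d @^-1` [set s | s <= r]); last first.
    by apply/seteqP; split => g /=; rewrite lee_fin.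
  apply: preimage_closed; last exact: closed_le.
  move=> g _; apply: (@cvg_dotp R n _ (nbhs g) _ id (cst d)); first exact: cvg_id.
  exact: cvg_cst.
- rewrite (_ : [set g | _] = setT); first exact: closedT.
  by apply/seteqP; split => g //= _; rewrite leey.
- by rewrite (_ : [set g | _] = set0); [exact: closed0|apply/seteqP; split => g].
Qed.

Lemma clarke_subdiff_convex x : convex_set (clarke_subdiff f x).
Proof.
move=> g h t; rewrite !inE => gx hx d; rewrite /conv/= dotpDl !dotpZl.
have := gx d; have := hx d; case: (clarke_dir f x d) => [r||]//;
  last by move=> _ _; rewrite leey.
rewrite !lee_fin => hr gr.
have t0 : 0 <= t%:num by [].
have t1 : t%:num <= 1 by [].
rewrite (le_trans (lerD (ler_wpM2l t0 gr) (ler_wpM2l _ hr)))//.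
  by rewrite subr_ge0.
by rewrite -mulrDl addrC subrK mul1r.
Qed.

(** Testing the defining inequality in the direction [g] itself gives |g|^2 <= g.g <= L |g|, with
    [L] a Lipschitz constant near [x]. *)
Lemma clarke_subdiff_bounded x : exists B, forall g, clarke_subdiff f x g -> `|g| <= B.
Proof.
have [U xU [L L0 UL]] := locally_lipschitz_bound x.
exists L => g gx; have [->|g0] := eqVneq g 0; first by rewrite normr0 ltW.
rewrite -(ler_pM2r (_ : 0 < `|g|)) ?normr_gt0// -expr2.
rewrite (le_trans (sqr_mx_norm_le_dotp g))// -lee_fin (le_trans (gx g))//.
pose A := [set ut : V * R | [/\ U ut.1, U (ut.1 + ut.2 *: g) & 0 < ut.2]].
have FA : filter_prod (nbhs x) (0 : R)^'+ A.
  have xg : (ut.1 + ut.2 *: g) @[ut --> filter_prod (nbhs x) (0 : R)^'+] --> x.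
    rewrite -[X in _ --> X]addr0 -(scale0r g); apply: cvgD; first exact: cvg_fst.
    apply: cvgZ; last exact: cvg_cst.
    by apply: cvg_trans (cvg_within _); exact: cvg_snd.
  have U1 : filter_prod (nbhs x) (0 : R)^'+ [set ut | U ut.1].
    by exists (U, setT) => /=; [split => //; exact: filterT | case=> u t []].
  have U2 : filter_prod (nbhs x) (0 : R)^'+ [set ut | 0 < ut.2].
    exists (setT, [set t | 0 < t]) => /=; last by case=> u t [].
    by split; [exact: filterT | exact: nbhs_right_gt].
  apply: filterS (filterI (filterI U1 (xg _ xU)) U2).
  by move=> ut [[]].
apply: (@le_trans _ _ (ereal_sup
    [set ((f (ut.1 + ut.2 *: g) - f ut.1) / ut.2)%:E | ut in A])).
  by apply: ereal_inf_lbound; exists A.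
apply: ge_ereal_sup => _ [[u t] [/= Uu Ut t0] <-].
rewrite lee_fin ler_pdivrMr// (le_trans (ler_norm _))// (le_trans (UL _ _ Ut Uu))//.
by rewrite addrAC subrr add0r normrZ gtr0_norm// -mulrA [t * _]mulrC.
Qed.

End Clarke.

(** * The upper envelope of the oracle and criticality *)

Section Oracle.
Context {R : realType} {n : nat}.
Local Notation V := 'cV[R]_n.

Lemma le_limn_esup (a : R) (v : nat -> R) :
  (forall e, 0 < e -> \forall k \near \oo, a - e <= v k) ->
  (a%:E <= limn_esup (fun k => (v k)%:E))%E.
Proof.
move=> av; apply: le_ereal_inf_tmp => _ [A [N _ NA] <-].
apply/lee_subgt0Pr => e e0; have [K _ Kv] := av e e0.
have kA : A (maxn N K) by apply: NA; rewrite /= leq_maxl.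
apply: (@le_trans _ _ (v (maxn N K))%:E); last first.
  by apply: ereal_sup_ubound; exists (maxn N K).
by rewrite -EFinB lee_fin; apply: Kv; rewrite /= leq_maxr.
Qed.

Lemma plane_at_center (x : V) (p : plane R n) : plane_at x p x = p.1.
Proof. by rewrite /plane_at subrr dotp0r addr0. Qed.

(** The supremum of these planes is the upper envelope of the oracle at [x]; the radius [M] is the
    one occurring in (O2) and (O4). *)
Definition nearby_planes (nrm : V -> R) (M : R) (O : V -> V -> set (plane R n))
    (x : V) : set (plane R n) :=
  [set p | exists2 z, cball nrm x M z & O z x p].

Context (nrm : V -> R) (f : V -> R) (M : R) (O : V -> V -> set (plane R n)).
Context (hnrm : is_norm nrm) (fL : locally_lipschitz f)
  (hO : cutting_plane_oracle f nrm M O).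

Lemma cball_norm_bound (r : R) :
  exists B, forall x z : V, `|x| <= r -> cball nrm x M z -> `|z| <= B.
Proof.
have [c c0 Nc] := mx_norm_le_norm hnrm.
exists (c * M + r) => x z xr xz; rewrite -(subrK x z) (le_trans (ler_normD _ _))//.
by rewrite lerD// (le_trans (Nc _))// ler_pM2l.
Qed.

Lemma nearby_planes_bounded (r : R) : exists B, forall x p, `|x| <= r ->
  nearby_planes nrm M O x p -> `|p.1| <= B /\ `|p.2| <= B.
Proof.
have [B zB] := cball_norm_bound r.
pose A := [set zx : V * V | `|zx.2| <= r /\ cball nrm zx.2 M zx.1].
have bA : bounded_set A.
  exists (Num.max r B); split; [exact: num_real | move=> s rs [z x] [/= xr xz]].
  rewrite prod_normE/= ge_max !ltW//.
    by apply: le_lt_trans rs; rewrite le_max xr.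
  by apply: le_lt_trans rs; rewrite le_max (zB _ _ xr xz) orbT.
have /pinfty_ex_gt0[D D0 DP] := oracle_bounded hO bA.
exists D => x p xr [z xz Op].
have /(_ p) : forall p, (\bigcup_(zx in A) O zx.1 zx.2) p -> `|p| <= D := DP.
rewrite prod_normE/= ge_max => /(_ _)/andP; apply.
by exists (z, x).
Qed.

(** Upper semicontinuity of the envelope in [x]: the points producing the planes stay bounded, so
    (O4) applies along a subsequence and returns a single plane carrying the limit value. *)
Lemma nearby_planes_limit (x u : V) (a : R) (xk : nat -> V) (p : nat -> plane R n) :
  xk @ \oo --> x -> (forall k, nearby_planes nrm M O (xk k) (p k)) ->
  (forall k, a - k.+1%:R^-1 <= plane_at (xk k) (p k) u) ->
  exists2 q, nearby_planes nrm M O x q & a <= plane_at x q u.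
Proof.
move=> xkx pO ap.
have /choice[z zP] : forall k, exists z, cball nrm (xk k) M z /\ O z (xk k) (p k).
  by move=> k; have [z] := pO k; exists z.
have [r xr] : exists r, forall k, `|xk k| <= r.
  have /cvg_seq_bounded : cvgn xk by apply/cvg_ex; exists x.
  by move=> /pinfty_ex_gt0[r _ rP]; exists r => k; exact: rP.
have [B zB] := cball_norm_bound r.
have [l [h [hk zl]]] := bounded_seq_subseq (fun k => zB _ _ (xr k) (zP k).1).
have [z' [q [z'x Oq le_q]]] := oracle_O4 hO (z := l) (y := u) (x := x)
  (zj := z \o h) (yj := cst u) (xj := xk \o h) (p := p \o h) zl (cvg_cst u)
  (cvg_subseq hk xkx) (fun k => (zP (h k)).1) (fun k => (zP (h k)).2).
exists q; first by exists z'.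
rewrite -lee_fin; apply: le_trans le_q; apply: le_limn_esup => e e0.
apply: filterS (near_infty_natSinv_lt (PosNum e0)) => k /= ke.
apply: le_trans (ap (h k)); rewrite lerB// (le_trans _ (ltW ke))//.
by rewrite lef_pV2 ?posrE// ler_nat ltnS hk.
Qed.

(** For t = 1 / (k + 1) the plane (a, g) satisfies a <= f x <= a + t g.d. Hence g.d >= 0, and a
    tends to f x because [g] is bounded, so (O2) puts the limit of a subsequence of the slopes in
    the Clarke subdifferential. *)
Lemma nearby_planes_clarke (x d : V) :
  (forall t, 0 < t <= 1 ->
    exists2 p, nearby_planes nrm M O x p & f x <= plane_at x p (x + t *: d)) ->
  exists2 g, clarke_subdiff f x g & 0 <= dotp g d.
Proof.
move=> fp.
have t01 k : 0 < (k.+1%:R^-1 : R) <= 1 by rewrite invr_gt0 ltr0n/= invf_le1 ?ler1n.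
have /choice[zp zpP] : forall k, exists zp : V * plane R n,
    [/\ cball nrm x M zp.1, O zp.1 x zp.2 &
      f x <= zp.2.1 + k.+1%:R^-1 * dotp zp.2.2 d].
  move=> k; have [p [z xz Op] fle] := fp _ (t01 k); exists (z, p); split => //=.
  by move: fle; rewrite /plane_at addrAC subrr add0r dotpZr.
have [B pB] := nearby_planes_bounded `|x|.
have pkB k : `|(zp k).2.2| <= B.
  by have [xz Op _] := zpP k; have [] := pB x (zp k).2 (lexx _) (ex_intro2 _ _ _ xz Op).
have [g [h [hk gl]]] := bounded_seq_subseq pkB.
have dp k : 0 <= dotp (zp k).2.2 d.
  have [_ Op fle] := zpP k; have /andP[k0 _] := t01 k.
  by have := le_trans (oracle_O1_below hO Op) fle; rewrite lerDl pmulr_rge0.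
exists g; last first.
  have gd : dotp (zp (h k)).2.2 d @[k --> \oo] --> dotp g d.
    by apply: cvg_dotp => //; exact: cvg_cst.
  by apply: (le_cvg_seq (cvg_cst 0) gd) => k; exact: dp.
have B0 : 0 <= B by apply: le_trans (pkB 0%N).
have lo : (f x - k.+1%:R^-1 * (n%:R * B * `|d|)) @[k --> \oo] --> f x.
  rewrite -[X in _ --> X]subr0 -(mul0r (n%:R * B * `|d|)).
  by apply: cvgB; [exact: cvg_cst | apply: cvgMr_tmp; exact: cvg_harmonic].
apply: (oracle_O2 hO (z := fun k => (zp (h k)).1) (p := fun k => (zp (h k)).2)).
- by move=> k; have [] := zpP (h k).
- apply: (squeeze_cvgr _ (cvg_subseq hk lo) (cvg_cst (f x))); apply: nearW => k /=.
  have [_ Op fle] := zpP (h k); rewrite (oracle_O1_below hO Op) andbT.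
  rewrite lerBlDr (le_trans fle)// lerD2l ler_pM2l ?invr_gt0//.
  by rewrite (le_trans (ler_norm _))// (le_trans (dotp_le _ _))// ler_wpM2r// ler_wpM2l.
- by move=> k; have [] := zpP (h k).
- exact: gl.
Qed.

(** Convexity supplies the points x + t (u - x), hence a subgradient with g.(u - x) >= 0 for each
    [u]. The minimax lemma makes one [g] serve all [u], and then [- g] is normal to [C]. *)
Lemma critical_of_nearby_planes (C : set V) (x : V) :
  closed C -> convex_set C -> C x ->
  (forall u, C u -> exists2 p, nearby_planes nrm M O x p & f x <= plane_at x p u) ->
  critical f C x.
Proof.
move=> Ccl Ccv Cx fp.
have [|g gx gC] := uniform_ascent_multiplier Ccl Ccv Cx (@clarke_subdiff_closed _ _ f x)
  (@clarke_subdiff_convex _ _ f x) (clarke_subdiff_bounded fL x).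
  move=> u Cu; apply: nearby_planes_clarke => t /andP[t0 t1]; apply: fp.
  by apply: convex_set_segment; rewrite // ltW.
exists g => //; exists (- g); last by rewrite subrr.
by split => // u Cu; rewrite dotpNl oppr_le0 gC.
Qed.

End Oracle.

(** * Invariants of the working models *)

Section WorkingModel.
Context {R : realType} {n : nat}.
Local Notation V := 'cV[R]_n.
Context (nrm : V -> R) (f : V -> R) (C : set V) (M : R)
  (O : V -> V -> set (plane R n)) (prm : btr_params R).
Context (hnrm : is_norm nrm) (M0 : 0 < M) (hO : cutting_plane_oracle f nrm M O).
Implicit Types (x y z u v g : V) (W : set (plane R n)) (Q : 'M[R]_n).

(* The aggregate plane minorises the model on C only, hence the restriction to
   C in the last field. *)
Record model_spec x W : Prop := ModelSpec {
  model_below : forall p, W p -> p.1 <= f x ;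
  model_exact : W `&` exactness_planes f O x !=set0 ;
  model_ubound : forall u, has_ubound [set plane_at x p u | p in W] ;
  model_nearby : forall u e p, C u -> 0 < e -> W p ->
    exists2 q, nearby_planes nrm M O x q & plane_at x p u <= plane_at x q u + e
}.

Section ModelTheory.
Context (x : V) (W : set (plane R n)) (hW : model_spec x W).

Lemma model_has_sup u : has_sup [set plane_at x p u | p in W].
Proof.
split; last exact: model_ubound hW u.
by have [p [Wp _]] := model_exact hW; exists (plane_at x p u), p.
Qed.

Lemma phi_ge u p : W p -> plane_at x p u <= phi W x u.
Proof.
by move=> Wp; apply: ub_le_sup; [exact: model_ubound hW u | exists p].
Qed.

Lemma phi_adherent u e : 0 < e -> exists2 p, W p & phi W x u - e < plane_at x p u.
Proof.
by move=> /sup_adherent/(_ (model_has_sup u))[_ [p Wp <-]]; exists p.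
Qed.

Lemma phi_le u a : (forall p, W p -> plane_at x p u <= a) -> phi W x u <= a.
Proof.
move=> Wa; apply: ge_sup; first by have [] := model_has_sup u.
by move=> _ [p Wp <-]; exact: Wa.
Qed.

Lemma phi_center : phi W x x = f x.
Proof.
apply/eqP; rewrite eq_le; apply/andP; split.
  by apply: phi_le => p Wp; rewrite plane_at_center (model_below hW).
have [p [Wp [_ <-]]] := model_exact hW.
by rewrite -(plane_at_center x p) phi_ge.
Qed.

Lemma phi_nearby u e : C u -> 0 < e ->
  exists2 q, nearby_planes nrm M O x q & phi W x u - e <= plane_at x q u.
Proof.
move=> Cu e0; have e2 : 0 < e / 2 by rewrite divr_gt0.
have [p Wp pu] := phi_adherent u e2.
have [q Oq pq] := model_nearby hW Cu e2 Wp.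
exists q => //; lra.
Qed.

End ModelTheory.

Lemma aggregate_le x Q W r y g z u :
  trial_step f C nrm prm x Q W r y g z -> C u ->
  phi W x y + dotp g (u - y) <= phi W x u.
Proof.
move=> ts Cu; have [_ /(_ u)] := aggregate_subgradient ts.
have [Cy _] := tangent_feasible ts.
by rewrite /indicator !mem_set// !adde0 -EFinD lee_fin.
Qed.

Lemma aggregate_plane_at W x y g u :
  plane_at x (aggregate_plane W x y g) u = phi W x y + dotp g (u - y).
Proof.
by rewrite /plane_at /= -addrA -dotpDr [x - y + _]addrC subrKA.
Qed.

Lemma exactness_nearby x p : exactness_planes f O x p -> nearby_planes nrm M O x p.
Proof. by move=> [Op _]; exists x => //; rewrite /cball/= subrr is_norm0// ltW. Qed.

Lemma nearby_planes_ubound x u : exists B, forall p, nearby_planes nrm M O x p ->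
  plane_at x p u <= B.
Proof.
have [B pB] := nearby_planes_bounded hnrm hO `|x|.
exists (B + n%:R * B * `|u - x|) => p Op; have [p1 p2] := pB _ _ (lexx _) Op.
rewrite /plane_at lerD//; first exact: le_trans (ler_norm _) p1.
by rewrite (le_trans (ler_norm _))// (le_trans (dotp_le _ _))// ler_wpM2r// ler_wpM2l.
Qed.

Lemma nearby_below x p : nearby_planes nrm M O x p -> p.1 <= f x.
Proof. by move=> [z _ Op]; exact: (oracle_O1_below hO Op). Qed.

Lemma model_spec_nearby x W : W `<=` nearby_planes nrm M O x ->
  W `&` exactness_planes f O x !=set0 -> model_spec x W.
Proof.
move=> WO ex; split => // [p /WO|u|u e p _ e0 /WO]; first exact: nearby_below.
- have [B pB] := nearby_planes_ubound x u.
  by exists B => _ [p /WO Wp <-]; exact: pB.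
- by exists p => //; rewrite lerDl ltW.
Qed.

(** The aggregate plane minorises the old model on [C]. At [x], a point of [C], this bounds its
    value by [f x]; at [u] it lets the plane inherit the domination by nearby planes up to [e]. *)
Lemma model_spec_update x Q W r y g z Wn :
  model_spec x W -> C x -> trial_step f C nrm prm x Q W r y g z ->
  O z x `<=` nearby_planes nrm M O x ->
  working_set_update f O x y g z W Wn -> model_spec x Wn.
Proof.
move=> hW Cx ts Oz wu.
have Wn_cases p : Wn p ->
    [\/ W p, p = aggregate_plane W x y g | nearby_planes nrm M O x p].
  move=> /(update_rest wu)[[[]|]|]; [exact: Or31| |exact: Or32|].
    by move=> /exactness_nearby ?; apply: Or33.
  by move=> /Oz ?; exact: Or33.
split => [p /Wn_cases[|->|]||u|u e p Cu e0 /Wn_cases[|->|]].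
- by move=> Wp; apply: (model_below hW).
- by rewrite -(plane_at_center x) aggregate_plane_at -(phi_center hW) (aggregate_le ts).
- exact: nearby_below.
- exact: update_exactness wu.
- have [B1 B1P] := model_ubound hW u.
  have [B2 B2P] := nearby_planes_ubound x u.
  exists (Num.max B1 (Num.max B2 (phi W x y + dotp g (u - y)))).
  move=> _ [p /Wn_cases Wp <-]; rewrite !le_max.
  case: Wp => [Wp|->|Op]; last by rewrite B2P ?orbT.
    by rewrite B1P//; exists p.
  by rewrite aggregate_plane_at lexx !orbT.
- by move=> Wp; exact: (model_nearby hW Cu e0 Wp).
- have [q Oq] := phi_nearby hW Cu e0; exists q => //.
  by rewrite aggregate_plane_at (le_trans (aggregate_le ts Cu))// -lerBlDr.
- by move=> Op; exists p => //; rewrite lerDl ltW.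
Qed.

Lemma inner_loop_model x Q E Rs L k :
  inner_loop_spec f C O nrm prm E x Q Rs L -> C x ->
  oracle_calls x L `<=` cball nrm x M -> (k <= serious L)%N ->
  model_spec x (planes L k).
Proof.
move=> il Cx xM; elim: k => [_|k ih kL].
  apply: model_spec_nearby; last exact: il_exactness0 il.
  by move=> p /(il_planes0 il)[z zx Op]; exists z => //; apply: xM; left.
apply: (model_spec_update (ih (ltnW kL)) Cx (il_trial il (ltnW kL)) _
  (il_null_planes il kL)).
by move=> p Op; exists (trial L k) => //; apply: xM; right; exists k.
Qed.

End WorkingModel.

(** * Tangent steps near a noncritical point *)

Section TangentStep.
Context {R : realType} {n : nat}.
Local Notation V := 'cV[R]_n.
Context (nrm : V -> R) (mnrm : 'M[R]_n -> R) (f : V -> R) (C : set V) (M : R)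
  (O : V -> V -> set (plane R n)) (prm : btr_params R).
Context (hnrm : is_norm nrm) (hmnrm : is_norm mnrm) (fL : locally_lipschitz f)
  (Ccl : closed C) (Ccv : convex_set C) (M0 : 0 < M)
  (hO : cutting_plane_oracle f nrm M O).
Implicit Types (x y z u v w g d : V) (W : set (plane R n)) (Q : 'M[R]_n).

(** Expand the nonnegative form of [Q] at [w - s *: d]. The parameter [s] lets a small value of w.Qw
    control the cross term. *)
Lemma psd_young Q w d (s : R) : symmetric_psd Q -> 0 < s ->
  dotp (Q *m w) d <= 2^-1 * (dotp w (Q *m w) / s + s * dotp d (Q *m d)).
Proof.
move=> [Qt Qp] s0; have := Qp (w - s *: d).
have wQd : dotp w (Q *m d) = dotp (Q *m w) d by rewrite dotp_mulmx Qt.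
rewrite mulmxBr -scalemxAr !dotpBl !dotpBr !dotpZl !dotpZr wQd (dotpC d) => h.
rewrite -(ler_pM2l s0) [leRHS]mulrCA mulrDr [s * (_ / s)]mulrC divfK ?gt_eqF//; lra.
Qed.

Lemma trial_step_radius x Q W r y g z :
  trial_step f C nrm prm x Q W r y g z -> 0 <= r.
Proof.
by move=> ts; have [_] := tangent_feasible ts; apply: le_trans; exact: is_norm_ge0.
Qed.

(** The aggregate inequality at u = x reads delta >= w.Qw / 2 + v.w, with both terms nonnegative.
    Testing the normality of [v] at the ball point x + (r / nrm v) v gives r v.v <= (nrm v) v.w. The
    last bound is the aggregate inequality at [u] with g = -(Q w) - v. *)
Lemma tangent_step_estimate x Q W r y g z :
  model_spec nrm f C M O x W -> C x -> symmetric_psd Q ->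
  trial_step f C nrm prm x Q W r y g z ->
  exists v, [/\ 2^-1 * dotp (y - x) (Q *m (y - x)) <= f x - Phi W Q x y,
    r * dotp v v <= nrm v * (f x - Phi W Q x y) &
    forall u, C u ->
      f x - (f x - Phi W Q x y) - dotp (Q *m (y - x)) (u - x) - dotp v (u - x)
        <= phi W x u].
Proof.
move=> hW Cx [Qt Qp] ts; have r0 := trial_step_radius ts.
have [v [_ vN] eq0] := aggregate_equation ts.
have gE : g = - (Q *m (y - x)) - v.
  by apply/eqP; rewrite -subr_eq0 opprD !opprK addrA eq0.
have phi_ge u : C u -> phi W x y + dotp g (u - x) + dotp g (x - y) <= phi W x u.
  move=> Cu; rewrite -addrA -dotpDr subrKA; exact: aggregate_le ts Cu.
have := phi_ge _ Cx; rewrite subrr dotp0r addr0 (phi_center hW).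
have wE : x - y = - (y - x) by rewrite opprB.
have QwC : dotp (Q *m (y - x)) (y - x) = dotp (y - x) (Q *m (y - x)) by exact: dotpC.
have vw0 : 0 <= dotp v (y - x).
  have := vN x; rewrite /cball/= subrr is_norm0// wE dotpNr oppr_le0; exact.
have gw : dotp g (x - y) = dotp (y - x) (Q *m (y - x)) + dotp v (y - x).
  by rewrite wE gE dotpNr (dotpBl _ v) dotpNl QwC; lra.
have q0 := Qp (y - x).
rewrite gw => fx; exists v; split; rewrite /Phi; first lra.
- apply: (@le_trans _ _ (nrm v * dotp v (y - x))); last first.
    by rewrite ler_wpM2l ?is_norm_ge0//; lra.
  have [->|v0] := eqVneq v 0; first by rewrite !dotp0l !mulr0.
  have nv0 := is_norm_gt0 hnrm v0.
  have /vN : cball nrm x r (x + (r / nrm v) *: v).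
    rewrite /cball/= addrAC subrr add0r (is_norm_homogeneous hnrm).
    by rewrite ger0_norm ?divr_ge0 ?(ltW nv0)// divfK ?gt_eqF.
  rewrite (_ : x + _ - y = (r / nrm v) *: v - (y - x)); last first.
    by rewrite opprB addrAC addrC.
  by rewrite (dotpBr _ (_ *: _)) dotpZr subr_le0 mulrAC ler_pdivrMr//
    mulrC [leRHS]mulrC.
- move=> u Cu; apply: le_trans (phi_ge _ Cu); rewrite gw gE (dotpBl _ v) dotpNl.
  lra.
Qed.

(** Otherwise there are tangent steps arbitrarily close to [xstar] with delta small both absolutely
    and relative to r. Then [v] is small too, so at each [u] in [C] the models nearly reach
    [f xstar], and planes in the limit make [xstar] critical. *)
Lemma noncritical_decrease xstar (q : R) : C xstar -> ~ critical f C xstar ->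
  exists eta kappa : R, [/\ 0 < eta, 0 < kappa &
    forall x Q W r y g z, C x -> `|x - xstar| < eta ->
      symmetric_psd Q -> mnrm Q <= q -> model_spec nrm f C M O x W ->
      trial_step f C nrm prm x Q W r y g z ->
      f x - Phi W Q x y < eta -> kappa * r <= f x - Phi W Q x y].
Proof.
move=> Cxs nc; apply: contrapT => H; apply: nc.
apply: (critical_of_nearby_planes hnrm fL hO Ccl Ccv Cxs) => u Cu.
have [c c0 Nc] := norm_le_mx_norm hnrm.
have [c' c'0 Nc'] := mx_norm_le_norm hmnrm.
suff approx : forall e, 0 < e -> exists x W, [/\ C x, `|x - xstar| <= e,
    model_spec nrm f C M O x W & f xstar - e <= phi W x u].
  have /choice[xp xpP] : forall k, exists xp : V * plane R n,
      [/\ `|xp.1 - xstar| <= k.+1%:R^-1, nearby_planes nrm M O xp.1 xp.2 &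
        f xstar - k.+1%:R^-1 <= plane_at xp.1 xp.2 u].
    move=> k; have k2 : 0 < (k.+1%:R^-1 / 2 : R) by rewrite divr_gt0// invr_gt0.
    have [x [W [Cx xxs hW fphi]]] := approx _ k2.
    have [p Op pu] := phi_nearby hW Cu k2.
    exists (x, p); split => //=; last by move: fphi pu; move: (k.+1%:R^-1) => t; lra.
    by rewrite (le_trans xxs)// ler_piMr ?invr_ge0//; lra.
  apply: (@nearby_planes_limit _ _ _ _ _ _ hnrm hO xstar u _ (fst \o xp) (snd \o xp)).
  - by apply: cvg_norm_le_harmonic => k; have [] := xpP k.
  - by move=> k; have [] := xpP k.
  - by move=> k; have [] := xpP k.
move=> e e0.
(* Five errors of size e / 5: f x against f xstar, delta, the two Young terms for Qw.(u - x), and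
   v.(u - x). *)
have e5 : 0 < e / 5 by rewrite divr_gt0.
(* [D] bounds |u - x| and [K] the form of [Q] at u - x. The choice of [s] controls the Young term s
   K, the later bound [eta <= s * (e / 5)] controls delta / s, and [kappa] controls v.(u - x). *)
pose D := `|u| + (`|xstar| + 1).
have D0 : 0 < D by rewrite /D ltr_wpDl// ltr_wpDl.
pose K := n%:R * D * (n%:R * `|c' * q| * D).
have K0 : 0 <= K by rewrite !mulr_ge0// ltW.
pose s := e / 5 / (K + 1).
have s0 : 0 < s by rewrite divr_gt0// ltr_wpDl.
pose kappa := e / 5 / (n%:R * c * D + 1).
have ncD0 : 0 <= n%:R * c * D by rewrite !mulr_ge0// ltW.
have kappa0 : 0 < kappa by rewrite divr_gt0// ltr_wpDl.
have /nbhs_ballP[rf rf0 frf] :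
    nbhs xstar [set x | `|f xstar - f x| < e / 5].
  exact: (proj1 (@cvgrPdist_lt _ _ _ _ (nbhs_filter xstar) f _)
    (locally_lipschitz_continuous fL (x := xstar)) _ e5).
have [eta [eta0 e_rf e_1 [e_e e_e5 e_s]]] : exists eta : R,
    [/\ 0 < eta, eta <= rf, eta <= 1 &
      [/\ eta <= e, eta <= e / 5 & eta <= s * (e / 5)]].
  exists (Num.min rf (Num.min 1 (Num.min e (Num.min (e / 5) (s * (e / 5)))))).
  by rewrite !lt_min !ge_min !lexx !orbT rf0 e0 e5 ltr01 mulr_gt0.
have /existsNP[x /existsNP[Q /existsNP[W
    /existsNP[r /existsNP[y /existsNP[g /existsNP[z]]]]]]] :
    ~ (forall x Q W r y g z, C x -> `|x - xstar| < eta ->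
      symmetric_psd Q -> mnrm Q <= q -> model_spec nrm f C M O x W ->
      trial_step f C nrm prm x Q W r y g z ->
      f x - Phi W Q x y < eta -> kappa * r <= f x - Phi W Q x y).
  by move=> h; apply: H; exists eta, kappa.
move=> /not_implyP[Cx] /not_implyP[xxs] /not_implyP[hQ] /not_implyP[Qq].
move=> /not_implyP[hW] /not_implyP[ts] /not_implyP[del /negP]; rewrite -ltNge => delr.
have [v [wQw rv phiu]] := tangent_step_estimate hW Cx hQ ts.
exists x, W; split => //; first by rewrite (le_trans (ltW xxs)).
have del0 : 0 <= f x - Phi W Q x y.
  by apply: le_trans wQw; rewrite mulr_ge0// (proj2 hQ).
apply: le_trans (phiu _ Cu).
have r0 : 0 < r by rewrite -(pmulr_rgt0 _ kappa0) (le_lt_trans del0).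
(* Divide r v.v <= (nrm v) delta by r |v|, using delta < kappa r. *)
have vb : `|v| <= c * kappa.
  have [->|v0] := eqVneq v 0; first by rewrite normr0 mulr_ge0// ltW.
  have nv : 0 < `|v| by rewrite normr_gt0.
  have h1 : r * `|v| ^+ 2 <= c * `|v| * (kappa * r).
    apply: (@le_trans _ _ (nrm v * (f x - Phi W Q x y))).
      by apply: le_trans rv; rewrite ler_pM2l// sqr_mx_norm_le_dotp.
    apply: ler_pM; [exact: is_norm_ge0|exact: del0| |exact: ltW].
    exact: (Nc v).
  rewrite -(ler_pM2l (mulr_gt0 r0 nv)); move: h1; rewrite expr2.
  rewrite mulrA => /le_trans; apply; rewrite le_eqVlt; apply/orP; left.
  by apply/eqP; ring.
have uxD : `|u - x| <= D.
  rewrite (_ : u - x = u - (xstar + (x - xstar))); last by rewrite subrKC.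
  rewrite (le_trans (ler_normB _ _))// lerD2l (le_trans (ler_normD _ _))// lerD2l.
  by rewrite (le_trans (ltW xxs)).
have fx : f xstar - e / 5 < f x.
  have : `|f xstar - f x| < e / 5.
    by apply: frf; rewrite -ball_normE /= distrC (lt_le_trans xxs).
  by rewrite ltr_norml => /andP[_]; lra.
have Qb : dotp (u - x) (Q *m (u - x)) <= K.
  rewrite (le_trans (ler_norm _))// (le_trans (dotp_le _ _))//.
  apply: ler_pM; [by rewrite mulr_ge0 | by [] | by rewrite ler_wpM2l |].
  rewrite (le_trans (mx_norm_mulmx _ _))//.
  apply: ler_pM; [by rewrite mulr_ge0 | by [] | | by []].
  rewrite ler_wpM2l// (le_trans (Nc' Q))// (le_trans _ (ler_norm _))//.
  by rewrite ler_pM2l.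
have Qwu : dotp (Q *m (y - x)) (u - x) <= e / 5 + e / 5.
  rewrite (le_trans (psd_young _ _ hQ s0))// mulrDr lerD//.
    rewrite mulrA ler_pdivrMr// (le_trans wQw)// (le_trans (ltW del))//.
    by rewrite mulrC.
  have : s * dotp (u - x) (Q *m (u - x)) <= s * (K + 1).
    by rewrite ler_pM2l// (le_trans Qb)// lerDl.
  rewrite {2}/s divfK ?gt_eqF ?ltr_wpDl//; lra.
have vu : dotp v (u - x) <= e / 5.
  rewrite (le_trans (ler_norm _))// (le_trans (dotp_le _ _))//.
  apply: (@le_trans _ _ (n%:R * (c * kappa) * D)).
    by apply: ler_pM; [rewrite mulr_ge0 | | rewrite ler_wpM2l |].
  rewrite (_ : n%:R * (c * kappa) * D = kappa * (n%:R * c * D)); last by ring.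
  rewrite /kappa mulrAC ler_pdivrMr ?ltr_wpDl// ler_pM2l//; lra.
lra.
Qed.

End TangentStep.

(** * Descent sequences with a cluster point *)

Section Descent.
Context {R : realType} {V : normedModType R}.

(** Monotonicity extends the convergence of the values from a subsequence tending to [xstar] to the
    whole sequence. *)
Lemma nonincreasing_cluster_cvg (f : V -> R) (x : nat -> V) (xstar : V) :
  continuous f -> cluster (x @ \oo) xstar -> (forall j, f (x j.+1) <= f (x j)) ->
  (forall j, f xstar <= f (x j)) /\ (f (x j) - f xstar) @[j --> \oo] --> 0.
Proof.
move=> fc /cluster_subseq[h hk xh] fx.
have fmono i j : (i <= j)%N -> f (x j) <= f (x i).
  elim: j => [|j ih]; first by rewrite leqn0 => /eqP ->.
  by rewrite leq_eqVlt => /orP[/eqP -> //|ij]; apply: le_trans (fx j) (ih ij).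
have fxh : f (x (h k)) @[k --> \oo] --> f xstar.
  exact: (@cvg_comp _ _ _ (x \o h) f _ _ _ xh (fc xstar)).
have flo j : f xstar <= f (x j).
  apply: (cvgr_to_le fxh); exists j => // k /= jk.
  by apply: fmono; exact: leq_trans (hk k).
split=> //; apply/cvgrPdist_lt => e e0.
have /cvgrPdist_lt/(_ e e0)[N _ /(_ N (leqnn N))/=] := fxh.
rewrite distrC ger0_norm ?subr_ge0// => fN.
exists (h N) => // j /= hj; rewrite sub0r normrN ger0_norm ?subr_ge0//.
by apply: le_lt_trans fN; rewrite lerD2r fmono.
Qed.

(* Steps dominated by the decrease of a function converging to 0 have small
   total length, so the sequence cannot leave the ball where this holds. *)
Lemma trapped_cvg (x : nat -> V) (a : nat -> R) (xstar : V) (r K : R) :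
  0 < r -> 0 <= K -> cluster (x @ \oo) xstar ->
  (forall j, 0 <= a j) -> a @ \oo --> 0 ->
  (\forall j \near \oo, `|x j - xstar| < r -> `|x j.+1 - x j| <= K * (a j - a j.+1)) ->
  x @ \oo --> xstar.
Proof.
move=> r0 K0 clx a0 acvg [N _ xN]; apply/cvgrPdist_lt => e e0.
pose s := Num.min e r; have s0 : 0 < s by rewrite lt_min e0 r0.
have s2 : 0 < s / 2 by rewrite divr_gt0.
have Ka : (K * a j) @[j --> \oo] --> 0.
  by rewrite -(mulr0 K); apply: cvgMl_tmp => //; exact: cvg_cst.
have /cvgrPdist_lt/(_ _ s2)[N' _ aN'] := Ka.
have [h hk xh] := cluster_subseq clx.
have /cvgrPdist_lt/(_ _ s2)[m _ xm] := xh.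
(* At [j0] the iterate is within s / 2 of [xstar], and K a(j0), which bounds all later travel, is
   below s / 2. *)
pose j0 := h (maxn m (maxn N N')).
have /= xj0 := xm (maxn m (maxn N N')) (leq_maxl _ _).
have /andP[Nj0 N'j0] : ((N <= j0) && (N' <= j0))%N.
  by rewrite -geq_max (leq_trans _ (hk _))// leq_maxr.
have Kaj0 : K * a j0 < s / 2.
  by have /= := aN' _ N'j0; rewrite sub0r normrN ger0_norm// mulr_ge0.
have close i : `|x i - x j0| <= K * (a j0 - a i) -> `|x i - xstar| < s.
  move=> xi; rewrite (splitr s) -(subrK (x j0) (x i)) -addrA.
  rewrite (le_lt_trans (ler_normD _ _))// ltrD//; last by rewrite distrC.
  by rewrite (le_lt_trans xi)// mulrBr (le_lt_trans _ Kaj0)// gerBl mulr_ge0.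
(* The bound at [i] keeps the iterate in the ball of radius [r], where the next step is controlled;
   the decreases telescope. *)
have path i : `|x (j0 + i)%N - x j0| <= K * (a j0 - a (j0 + i)%N).
  elim: i => [|i ih]; first by rewrite addn0 !subrr normr0 mulr0.
  rewrite addnS -(subrK (x (j0 + i)%N) (x _.+1)) -addrA.
  rewrite (le_trans (ler_normD _ _))//.
  have xstep := xN (j0 + i)%N (leq_trans Nj0 (leq_addr _ _)).
  have /xstep : `|x (j0 + i)%N - xstar| < r.
    by rewrite (lt_le_trans (close _ ih))// ge_min lexx orbT.
  by move=> xi; rewrite (le_trans (lerD xi ih))// -mulrDr [X in K * X <= _]addrC subrKA.
exists j0 => // j /= j0j; rewrite distrC.
have := close _ (path (j - j0)%N); rewrite subnKC// => /lt_le_trans; apply.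
by rewrite ge_min lexx.
Qed.

End Descent.

(** * Serious steps, null steps and radii *)

Section Algorithm.
Context {R : realType} {n : nat}.
Local Notation V := 'cV[R]_n.
Context (nrm : V -> R) (f : V -> R) (C : set V) (M : R)
  (O : V -> V -> set (plane R n)) (prm : btr_params R).
Context (hnrm : is_norm nrm) (M0 : 0 < M) (hO : cutting_plane_oracle f nrm M O)
  (hprm : valid_params prm).
Implicit Types (x y z g : V) (W : set (plane R n)) (Q : 'M[R]_n).

(** An exactness plane (f x, g) alone gives phi(y) >= f x + g.(y - x) with [g] bounded, and the
    quadratic term only lowers the defect. So a small radius forces a small delta. *)
Lemma tangent_defect_bound (d : R) : exists2 B, 0 <= B &
  forall x W Q y, `|x| <= d -> symmetric_psd Q -> model_spec nrm f C M O x W ->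
    f x - Phi W Q x y <= B * nrm (y - x).
Proof.
have [B pB] := nearby_planes_bounded hnrm hO d.
have [c c0 Nc] := mx_norm_le_norm hnrm.
exists (n%:R * `|B| * c) => [|x W Q y xd [_ Qp] hW]; first by rewrite !mulr_ge0// ltW.
have [p [Wp Op]] := model_exact hW.
have [_ p2] := pB _ _ xd (exactness_nearby hnrm M0 Op).
have := phi_ge hW y Wp; have := Qp (y - x); rewrite /Phi /plane_at (proj2 Op) => h1 h2.
apply: (@le_trans _ _ (- dotp p.2 (y - x))); first by lra.
rewrite (le_trans (ler_norm _))// normrN (le_trans (dotp_le _ _))// -[leRHS]mulrA.
apply: ler_pM; [by rewrite mulr_ge0 | by [] | | exact: Nc].
by rewrite ler_wpM2l// (le_trans p2)// ler_norm.
Qed.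

Lemma serious_decrease x Q W r y g z :
  trial_step f C nrm prm x Q W r y g z -> 0 <= f x - Phi W Q x y ->
  gamma prm <= rho f W Q x z ->
  gamma prm * theta prm * (f x - Phi W Q x y) <= f x - f z.
Proof.
move=> ts d0; have g0 := gamma_gt0 hprm; have th0 := theta_gt0 hprm.
have D := trial_decrease ts; rewrite /rho.
have D0 : 0 <= f x - Phi W Q x z by apply: le_trans D; rewrite mulr_ge0// ltW.
(* A zero denominator makes [rho] equal to 0, which is below gamma. *)
have [->|Dn] := eqVneq (f x - Phi W Q x z) 0; first by rewrite invr0 mulr0 leNgt g0.
rewrite ler_pdivlMr ?lt_def ?Dn// => /(le_trans _); apply.
by rewrite -mulrA ler_pM2l.
Qed.

(** With D the predicted decrease at [z], subtracting the two ratio tests shows that f z exceeds the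
    next model at [z] by at least (gammat - gamma) D, where D >= theta kappa r. The plane [p] bounds
    this gap by eps Theta r; divide by r. *)
Lemma null_step_defect x Q W Wn r y g z p (eps kappa : R) :
  model_spec nrm f C M O x Wn -> trial_step f C nrm prm x Q W r y g z ->
  0 < r -> 0 < kappa -> 0 < eps -> kappa * r <= f x - Phi W Q x y ->
  rho f W Q x z < gamma prm -> gammat prm <= rho_tilde f W Wn Q x z ->
  Wn p -> f z <= plane_at x p z + eps * nrm (z - x) ->
  (gammat prm - gamma prm) * (theta prm * kappa) <= eps * Theta prm.
Proof.
move=> hWn ts r0 k0 e0 kr; rewrite /rho /rho_tilde => rhoz rhot Wp fz.
have th0 := theta_gt0 hprm; have gg := gamma_lt_gammat hprm.
have Th1 := Theta_ge1 hprm.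
set D := f x - Phi W Q x z in rhoz rhot.
have DP : theta prm * kappa * r <= D.
  by apply: le_trans (trial_decrease ts); rewrite -mulrA ler_pM2l.
have D0 : 0 < D by apply: lt_le_trans DP; rewrite !mulr_gt0.
move: rhoz rhot; rewrite ltr_pdivrMr// ler_pdivlMr// => rhoz rhot.
have zr : nrm (z - x) <= Theta prm * r.
  apply: le_trans (trial_length ts) _; rewrite ler_pM2l ?(lt_le_trans _ Th1)//.
  by have [] := tangent_feasible ts.
have pz := phi_ge hWn z Wp.
rewrite -(ler_pM2r r0) -[leRHS]mulrA -[leLHS]mulrA.
apply: (@le_trans _ _ ((gammat prm - gamma prm) * D)).
  by rewrite ler_pM2l// subr_gt0.
apply: (@le_trans _ _ (eps * nrm (z - x))); last by rewrite ler_pM2l.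
by rewrite mulrBl; lra.
Qed.

Lemma inner_radius_gt0 x Q E Rs L k : inner_loop_spec f C O nrm prm E x Q Rs L ->
  0 < Rs -> (k <= serious L)%N -> 0 < Defs.radius L k.
Proof.
move=> il Rs0; elim: k => [_|k ih kL]; first by rewrite (il_radius0 il).
by rewrite (il_null_radius il kL); case: ifP => _; rewrite ?divr_gt0 ?ih// ltnW.
Qed.

(** In the second case [k] is the last halving before [m], after which the radius stays constant. *)
Lemma inner_radius_halved x Q E Rs L m : inner_loop_spec f C O nrm prm E x Q Rs L ->
  (m <= serious L)%N -> Defs.radius L m = Rs \/
  exists k, [/\ (k < serious L)%N, Defs.radius L k = 2 * Defs.radius L m &
    gammat prm <= rho_tilde f (planes L k) (planes L k.+1) Q x (trial L k)].
Proof.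
move=> il; elim: m => [_|m ih mL]; first by left; exact: il_radius0 il.
rewrite (il_null_radius il mL); case: ltP => rt.
  by have [->|[k [kL rk rtk]]] := ih (ltnW mL); [left|right; exists k].
by right; exists m; split => //; rewrite mulrC divfK.
Qed.

End Algorithm.

(** * Convergence of the iterates and the contradiction at null steps *)

Theorem theorem5p15 (R : realType) (n : nat)
    (nrm : 'cV[R]_n -> R) (mnrm : 'M[R]_n -> R)
    (f : 'cV[R]_n -> R) (C : set 'cV[R]_n)
    (M : R) (O : 'cV[R]_n -> 'cV[R]_n -> set (plane R n))
    (prm : btr_params R) (x1 : 'cV[R]_n) (run : btr_run R n) :
  is_norm nrm -> is_norm mnrm ->
  locally_lipschitz f ->
  closed C -> convex_set C ->
  0 < M -> cutting_plane_oracle f nrm M O -> strict_oracle f nrm O ->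
  valid_params prm ->
  C x1 -> bounded_set [set x | C x /\ f x <= f x1] ->
  bundle_trust_region f C O nrm mnrm prm x1 run ->
  (forall j, oracle_calls (iterate run j) (inner run j)
               `<=` cball nrm (iterate run j) M) ->
  forall xstar : 'cV[R]_n,
    cluster (iterate run @ \oo) xstar -> critical f C xstar.
Proof.
move=> hnrm hmnrm fL Ccl Ccv M0 hO strict hprm _ _ btr calls xstar clx.
apply: contrapT => nc.
pose x := iterate run; pose L j := inner run j.
have g0 := gamma_gt0 hprm; have th0 := theta_gt0 hprm.
have Th0 : 0 < Theta prm := lt_le_trans ltr01 (Theta_ge1 hprm).
have gt0 : 0 < gamma prm * theta prm by rewrite mulr_gt0.
have Cx j : C (x j).
  case: j => [|j]; first by rewrite /x (btr_start btr); exact: btr_startC btr.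
  rewrite /x (btr_iterate btr).
  exact: trial_feasible (il_trial (btr_inner btr j) (leqnn _)).
have model j k : (k <= serious (L j))%N ->
    model_spec nrm f C M O (x j) (planes (L j) k).
  move=> kL.
  by apply: (inner_loop_model hnrm M0 hO (btr_inner btr j)) => //; exact: calls.
have hQ j : symmetric_psd (hess run j) by have [] := btr_hess btr j.
pose del j k := f (x j) - Phi (planes (L j) k) (hess run j) (x j) (tangent (L j) k).
have ts j k : (k <= serious (L j))%N -> trial_step f C nrm prm (x j) (hess run j)
    (planes (L j) k) (Defs.radius (L j) k) (tangent (L j) k) (aggsub (L j) k)
    (trial (L j) k) := il_trial (btr_inner btr j) (k := k).
have del_ge0 j k : (k <= serious (L j))%N -> 0 <= del j k.
  move=> kL; have [v [wQw _ _]] :=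
    tangent_step_estimate hnrm (model j k kL) (Cx j) (hQ j) (ts j k kL).
  by apply: le_trans wQw; rewrite mulr_ge0// (proj2 (hQ j)).
pose S j := serious (L j).
have descent j : gamma prm * theta prm * del j (S j) <= f (x j) - f (x j.+1).
  rewrite /x (btr_iterate btr); apply: (serious_decrease hprm (ts j _ (leqnn _))).
    exact: (del_ge0 j _ (leqnn _)).
  exact: il_serious_rho (btr_inner btr j).
have fdec j : f (x j.+1) <= f (x j).
  rewrite -subr_ge0; apply: le_trans (descent j).
  by rewrite mulr_ge0// ?del_ge0// ltW.
have [flo fcvg] := nonincreasing_cluster_cvg
  (@locally_lipschitz_continuous _ _ _ fL) clx fdec.
have Cxs : C xstar.
  have [h _ xh] := cluster_subseq clx.
  by apply: (closed_cvg _ Ccl _ _ xh); apply: nearW => k; exact: Cx.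
have [eta [kappa [eta0 kappa0 key]]] :=
  noncritical_decrease prm hnrm hmnrm fL Ccl Ccv hO (qmax prm) Cxs nc.
have keyj j k : (k <= S j)%N -> `|x j - xstar| < eta -> del j k < eta ->
    kappa * Defs.radius (L j) k <= del j k.
  move=> kS xj dk.
  apply: (key _ _ _ _ _ _ _ (Cx j) xj (hQ j) _ (model j k kS) (ts j k kS) dk).
  by have [] := btr_hess btr j.
have [c c0 Nc] := mx_norm_le_norm hnrm.
pose A := gamma prm * theta prm * kappa; have A0 : 0 < A by rewrite mulr_gt0.
have step j k : (k <= S j)%N ->
    `|trial (L j) k - x j| <= c * Theta prm * Defs.radius (L j) k.
  move=> kS; rewrite (le_trans (Nc _))// -mulrA ler_pM2l//.
  rewrite (le_trans (trial_length (ts j k kS)))// ler_pM2l//.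
  by have [] := tangent_feasible (ts j k kS).
have fsmall e : 0 < e -> \forall j \near \oo, f (x j) - f xstar < e.
  move=> e0; move/cvgrPdist_lt : fcvg => /(_ e e0); apply: filterS => j.
  by rewrite sub0r normrN ger0_norm// subr_ge0.
(* Once the remaining decrease of [f] is below gamma theta eta, the descent bound forces delta <
   eta, so kappa r <= delta applies. *)
have radius_small : \forall j \near \oo, `|x j - xstar| < eta ->
    A * Defs.radius (L j) (S j) <= f (x j) - f (x j.+1).
  apply: filterS (fsmall _ (mulr_gt0 gt0 eta0)) => j fj xj.
  apply: le_trans (descent j); rewrite /A -[leLHS]mulrA ler_pM2l// keyj//.
  rewrite -(ltr_pM2l gt0); apply: le_lt_trans (descent j) (le_lt_trans _ fj).
  by rewrite lerD2l lerN2.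
(* Step lengths are at most c Theta r, and A r is at most the decrease of [f]. *)
have xcvg : x @ \oo --> xstar.
  apply: (trapped_cvg eta0 (K := c * Theta prm / A) _ clx _ fcvg).
  - by rewrite divr_ge0 ?mulr_ge0 ?(ltW A0)// ltW.
  - by move=> j; rewrite subr_ge0.
  - apply: filterS radius_small => j rj /rj {}rj.
    have : `|x j.+1 - x j| <= c * Theta prm * Defs.radius (L j) (S j).
      by rewrite /x (btr_iterate btr); exact: (step j).
    move=> /le_trans; apply; rewrite -[leRHS]mulrA ler_pM2l ?mulr_gt0//.
    by rewrite mulrC ler_pdivlMr// mulrC opprB subrKA.
have xnear e : 0 < e -> \forall j \near \oo, `|x j - xstar| < e.
  by move=> e0; move/cvgrPdistC_lt : xcvg; apply.
have rsmall e : 0 < e -> \forall j \near \oo, Defs.radius (L j) (S j) < e.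
  move=> e0; apply: filterS3 radius_small (xnear _ eta0) (fsmall _ (mulr_gt0 A0 e0)).
  move=> j rj xj fj; rewrite -(ltr_pM2l A0).
  apply: le_lt_trans (rj xj) (le_lt_trans _ fj).
  by rewrite lerD2l lerN2.
have mem_gt0 j : 0 < memory run j.
  elim: j => [|j ih]; first exact: btr_memory0 btr.
  have r0 := inner_radius_gt0 (btr_inner btr j) ih (leqnn _).
  by rewrite (btr_memory btr); case: ifP => _ //; rewrite mulr_gt0.
(* If late inner loops had no halving, each would end with its initial radius and the memory radius
   could not decrease, against [rsmall]. The radius before the last halving is twice the final one,
   whence e / 2. *)
have halved e : 0 < e -> exists j k, [/\ (k < S j)%N, `|x j - xstar| <= e,
    Defs.radius (L j) k <= e &
    gammat prm <= rho_tilde f (planes (L j) k) (planes (L j) k.+1) (hess run j)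
      (x j) (trial (L j) k)].
  move=> e0; have e2 : 0 < e / 2 by rewrite divr_gt0.
  have [N _ NP] := filterI (xnear _ e0) (rsmall _ e2).
  apply: contrapT => none.
  have mem_const j : (N <= j)%N -> Defs.radius (L j) (S j) = memory run j.
    move=> Nj; have [xj rj] := NP j Nj.
    have [//|[k [kS rk rtk]]] := inner_radius_halved (btr_inner btr j) (leqnn _).
    exfalso; apply: none; exists j, k; split => //; first exact: ltW.
    by move: rj; rewrite ltr_pdivlMr// mulrC -rk => /ltW.
  have mem_ge i : memory run N <= memory run (N + i)%N.
    elim: i => [|i ih]; first by rewrite addn0.
    rewrite addnS (btr_memory btr).
    rewrite -/(L (N + i)%N) -/(S (N + i)%N) mem_const ?leq_addr//.
    case: ifP => _ //; apply: le_trans ih _; have := mem_gt0 (N + i)%N; lra.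
  have [m _ mP] := rsmall _ (mem_gt0 N).
  have := mP (N + m)%N (leq_addl _ _); rewrite /= mem_const ?leq_addr//.
  by rewrite ltNge mem_ge.
have inv_gt0 k : 0 < (k.+1%:R^-1 : R) by rewrite invr_gt0.
have /choice[jk jkP] : forall l, exists jk : nat * nat, [/\ (jk.2 < S jk.1)%N,
    `|x jk.1 - xstar| <= l.+1%:R^-1, Defs.radius (L jk.1) jk.2 <= l.+1%:R^-1 &
    gammat prm <= rho_tilde f (planes (L jk.1) jk.2) (planes (L jk.1) jk.2.+1)
      (hess run jk.1) (x jk.1) (trial (L jk.1) jk.2)].
  by move=> l; have [j [k H]] := halved _ (inv_gt0 l); exists (j, k).
pose xl l := x (jk l).1; pose zl l := trial (L (jk l).1) (jk l).2.
have xlcvg : xl @ \oo --> xstar.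
  by apply: cvg_norm_le_harmonic => l; have [] := jkP l.
have zlcvg : zl @ \oo --> xstar.
  (* |z - xstar| <= c Theta r + |x - xstar|, and both r and |x - xstar| are at most 1 / (l + 1). *)
  have cT1 : 0 < c * Theta prm + 1 by rewrite ltr_wpDl// mulr_ge0// ltW.
  apply/cvgrPdistC_lt => e e0.
  have := near_infty_natSinv_lt (PosNum (divr_gt0 e0 cT1)).
  apply: filterS => l /=; rewrite ltr_pdivlMr// => le.
  have [kS xj rk _] := jkP l.
  apply: le_lt_trans le; rewrite -(subrK (xl l) (zl l)) -addrA.
  rewrite (le_trans (ler_normD _ _))// mulrDr mulr1 lerD//.
  by rewrite (le_trans (step _ _ (ltnW kS)))// mulrC ler_wpM2r// mulr_ge0// ltW.
(* The serious iterate varies along these null steps, so the locally uniform condition of the strict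
   oracle is used. Its planes lie in [O (zl l) (xl l)], hence in the next working set. *)
have [p [eps [pO eps0 epscvg pf]]] := strict _ _ _ xlcvg zlcvg.
have [B B0 defect] := tangent_defect_bound C hnrm M0 hO (`|xstar| + 1).
have eps_ge : \forall l \near \oo,
    (gammat prm - gamma prm) * (theta prm * kappa) / Theta prm <= eps l.
  (* [B + 1] is a positive divisor; radii below eta / (B + 1) give delta < eta through [defect]. *)
  have small := near_infty_natSinv_lt (PosNum (divr_gt0 eta0 (ltr_wpDl B0 ltr01))).
  have smalle := near_infty_natSinv_lt (PosNum eta0).
  apply: filterS2 small smalle => l /=; rewrite ltr_pdivlMr ?ltr_wpDl// => lB le.
  have [kS xj rk rt] := jkP l.
  have il := btr_inner btr (jk l).1.
  have ts' := ts _ _ (ltnW kS); have hW := model _ _ (ltnW kS).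
  have dl : del (jk l).1 (jk l).2 < eta.
    apply: le_lt_trans lB.
    have xl1 : `|x (jk l).1| <= `|xstar| + 1.
      rewrite -(subrKC xstar (x _)) (le_trans (ler_normD _ _))// lerD2l (le_trans xj)//.
      by rewrite invf_le1 ?ler1n.
    apply: le_trans (defect _ _ _ _ xl1 (hQ _) hW) _.
    rewrite mulrC ler_pM ?is_norm_ge0// ?lerDl//.
    by have [_ /le_trans] := tangent_feasible ts'; apply.
  have kr := keyj _ _ (ltnW kS) (le_lt_trans xj le) dl.
  have r0 := inner_radius_gt0 il (mem_gt0 _) (ltnW kS).
  rewrite ler_pdivrMr//.
  apply: (null_step_defect hprm (model _ _ kS) ts' r0 kappa0 (eps0 l) kr _ rt _ (pf l)).
    exact: il_null_rho il _ kS.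
  by apply: (update_cutting (il_null_planes il kS)); exact: pO.
have : (gammat prm - gamma prm) * (theta prm * kappa) / Theta prm <= 0.
  exact: (cvgr_to_ge epscvg eps_ge).
rewrite leNgt divr_gt0 ?mulr_gt0// subr_gt0; exact: gamma_lt_gammat.
Qed.
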